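(* Let $\Omega$ be a solvable sesquilinear form on $\mathcal{D}$ and let $T$ be the operator associated to $\Omega$. Suppose, moreover, that $\Upsilon\in\mathfrak{P}(\Omega)$ and $B\in\mathcal{B}(\mathcal{H})$ is the operator associated to $\Upsilon$ (that is, $\Upsilon(\xi,\eta)=\langle B\xi,\eta\rangle$ for all $\xi,\eta\in\mathcal{H}$). If $\Omega$ is hyper-solvable, then there exists a unique operator $V\in\mathcal{B}(\mathcal{H})$ such that $$\Omega(\xi,\eta)=\langle V|T+B|^{1/2}\xi,\ |T+B|^{1/2}\eta\rangle,\qquad\forall\,\xi,\eta\in\mathcal{D}.$$ In particular, if $0\in\rho(T)$, then there exists a unique bijection $W\in\mathcal{B}(\mathcal{H})$ such that $$\Omega(\xi,\eta)=\langle W|T|^{1/2}\xi,\ |T|^{1/2}\eta\rangle,\qquad\forall\,\xi,\eta\in\mathcal{D}.$$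
   Context: $\mathcal{H}$ is a complex Hilbert space with inner product $\langle\cdot,\cdot\rangle$ (linear in the first variable) and norm $\|\cdot\|$; $\mathcal{D}$ is a dense subspace of $\mathcal{H}$; sesquilinear forms are linear in the first and conjugate-linear in the second variable. $\mathcal{B}(\mathcal{H})$ is the set of bounded everywhere defined operators on $\mathcal{H}$ and $\rho(A)$ denotes the resolvent set of $A$. A sesquilinear form $\Omega$ on $\mathcal{D}$ is q-closed with respect to a norm $\|\cdot\|_\Omega$ on $\mathcal{D}$ if: (i) there is $\alpha>0$ with $\|\xi\|\le\alpha\|\xi\|_\Omega$ for all $\xi\in\mathcal{D}$; (ii) $\mathcal{E}_\Omega:=(\mathcal{D},\|\cdot\|_\Omega)$ is a reflexive Banach space; (iii) there is $\beta>0$ with $|\Omega(\xi,\eta)|\le\beta\|\xi\|_\Omega\|\eta\|_\Omega$ for all $\xi,\eta\in\mathcal{D}$. Let $\mathcal{E}_\Omega^\times$ be the space of bounded conjugate linear functionals on $\mathcal{E}_\Omega$. $\mathfrak{P}(\Omega)$ is the set of bounded sesquilinear forms $\Upsilon$ on $\mathcal{H}$ such that: (1) if $\xi\in\mathcal{D}$ and $(\Omega+\Upsilon)(\xi,\eta)=0$ for all $\eta\in\mathcal{D}$ then $\xi=0$; (2) for every $\Lambda\in\mathcal{E}_\Omega^\times$ there is $\xi\in\mathcal{D}$ with $\Lambda(\eta)=(\Omega+\Upsilon)(\xi,\eta)$ for all $\eta\in\mathcal{D}$. $\Omega$ is solvable (with respect to $\|\cdot\|_\Omega$) if it is q-closed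 and $\mathfrak{P}(\Omega)\neq\emptyset$; when no norm is mentioned, some such norm is understood (all such norms are known to be equivalent). The operator $T$ associated to a solvable form $\Omega$ is given by: $\xi\in D(T)$ and $T\xi=\chi$ if and only if $\xi\in\mathcal{D}$, $\chi\in\mathcal{H}$ and $\Omega(\xi,\eta)=\langle\chi,\eta\rangle$ for all $\eta\in\mathcal{D}$. It is known that $T$ is closed and densely defined. A solvable form $\Omega$ on $\mathcal{D}$ with associated operator $T$ is hyper-solvable if $\mathcal{D}=D(|T|^{1/2})$. For a closed densely defined operator $A$, $|A|=(A^*A)^{1/2}$. *)

(* Defs.v *)
From HB Require Import structures.
From mathcomp Require Import all_boot all_order all_algebra.
From mathcomp Require Import sesquilinear.
From mathcomp Require Export complex.
From mathcomp Require Import boolp classical_sets reals topology normedtype.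

Set Implicit Arguments.
Unset Strict Implicit.
Unset Printing Implicit Defensive.

Import Order.TTheory GRing.Theory Num.Theory.
Import numFieldNormedType.Exports.

Local Open Scope classical_set_scope.
Local Open Scope complex_scope.
Local Open Scope ring_scope.

(* A linear subspace of V, given by the predicate S, carrying a norm of its own
   for which it is complete; this norm need not be the one of V. The inclusion
   into V is val. *)
#[short(type="subBanachType")]
HB.structure Definition SubBanach (K : numFieldType) (V : lmodType K)
    (S : pred V) :=
  {E of @GRing.SubLmodule K V S E & CompleteNormedModule K E}.

Notation "{ 'sesquilinear' U }" :=
  ({bilinear U -> U -> _ | *%R & Num.conj \; *%R})
  (format "{ 'sesquilinear'  U }") : ring_scope.

Section Banach.
Context {R : realType}.

Definition bounded_map {U V : normedModType R[i]} (f : U -> V) :=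
  exists M : R[i], forall x, `|f x| <= M * `|x|.

Definition bounded_operator {U V : normedModType R[i]} (f : U -> V) :=
  linear f /\ bounded_map f.

Definition bounded_form {U : normedModType R[i]} (f : U -> U -> R[i]) :=
  exists2 M : R[i], 0 < M & forall x y, `|f x y| <= M * `|x| * `|y|.

Definition functional_bound {U : normedModType R[i]} (f : U -> R[i])
    (c : R[i]) :=
  0 <= c /\ forall x, `|f x| <= c * `|x|.

Definition dual {U : normedModType R[i]} : set (U -> R[i]) :=
  [set f | scalar f /\ exists c, functional_bound f c].

Definition conjugate_dual {U : normedModType R[i]} : set (U -> R[i]) :=
  [set f | linear_for (Num.conj \; *%R) f /\ exists c, functional_bound f c].

(* An element of the bidual is a map on U -> R[i] of which only the values on
   dual functionals matter; since the operator norm of f is the least c such that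
   functional_bound f c, the second hypothesis is |Phi f| <= M * ||f||. *)
Definition reflexive_space (U : normedModType R[i]) :=
  forall Phi : (U -> R[i]) -> R[i],
    (forall (a : R[i]) f g, dual f -> dual g ->
      Phi (fun x => a * f x + g x) = a * Phi f + Phi g) ->
    (exists M : R[i], forall f c, dual f -> functional_bound f c ->
      `|Phi f| <= M * c) ->
    exists x : U, forall f, dual f -> Phi f = f x.

End Banach.

(* Unbounded operators in H are represented by their graphs. *)
Section UnboundedOperators.
Context {R : realType} {H : completeNormedModType R[i]}.
Variable ip : {dot H for Num.conj}.
Implicit Types A S : set (H * H).

Definition hilbert := forall x : H, `|x| ^+ 2 = ip x x.

Definition op_dom A : set H := [set x | exists y, A (x, y)].

Definition op_comp A S : set (H * H) :=
  [set xz | exists y, S (xz.1, y) /\ A (y, xz.2)].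

Definition op_plus A (B : H -> H) : set (H * H) :=
  [set xz | exists y, A (xz.1, y) /\ xz.2 = y + B xz.1].

Definition op_adjoint A : set (H * H) :=
  [set yz | forall x w, A (x, w) -> ip w yz.1 = ip x yz.2].

(* Any adjoint is a linear subspace of H * H, and the adjoint of a graph with
   dense domain is single-valued: a selfadjoint graph is that of a densely
   defined linear operator. *)
Definition selfadjoint A := dense (op_dom A) /\ op_adjoint A = A.

Definition positive A := forall x y, A (x, y) -> 0 <= ip y x.

(* The positive square root A^(1/2); it exists and is unique when A is a
   positive selfadjoint operator. *)
Definition op_sqrt A : set (H * H) :=
  xget set0 [set S | [/\ selfadjoint S, positive S & op_comp S S = A]].

Definition op_abs A := op_sqrt (op_comp (op_adjoint A) A).

(* l is in the resolvent set when the graph of A - l is the inverse of that of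
   an everywhere defined bounded operator. *)
Definition resolvent_set A : set R[i] :=
  [set l | exists2 G : H -> H, bounded_operator G &
    forall x y, op_plus A (fun u => - (l *: u)) (x, y) <-> x = G y].

End UnboundedOperators.

Section SolvableForms.
Context {R : realType} {H : completeNormedModType R[i]}.
Variable ip : {dot H for Num.conj}.
Context {D : pred H} {E : subBanachType D}.
Variable Omega : {sesquilinear E}.

Definition q_closed :=
  [/\ exists2 alpha : R[i], 0 < alpha &
        forall x : E, `|val x : H| <= alpha * `|x|,
      reflexive_space E
    & bounded_form Omega].

Definition solving_perturbation (Ups : {sesquilinear H}) :=
  [/\ bounded_form Ups,
      forall x : E,
        (forall y : E, Omega x y + Ups (val x) (val y) = 0) -> x = 0
    & forall L, conjugate_dual L ->
        exists x : E, forall y : E, L y = Omega x y + Ups (val x) (val y)].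

Definition solvable := q_closed /\ exists Ups, solving_perturbation Ups.

Definition form_operator : set (H * H) :=
  [set xz | exists2 x : E, val x = xz.1 &
    forall y : E, Omega x y = ip xz.2 (val y)].

Definition hyper_solvable :=
  solvable /\ [set x | D x] = op_dom (op_sqrt ip (op_abs ip form_operator)).

(* Omega(x, y) = <V Q x, Q y> for all x, y in D, which entails that D is
   contained in the domain of Q. *)
Definition represented_by (Q : set (H * H)) (V : H -> H) :=
  forall x y : E, exists qx qy,
    [/\ Q (val x, qx), Q (val y, qy) & Omega x y = ip (V qx) qy].

End SolvableForms.

(* Main.v *)
Require Import Defs.
From mathcomp Require Import all_boot all_order all_algebra.
From mathcomp Require Import sesquilinear.
From mathcomp Require Import boolp classical_sets reals topology normedtype.
From mathcomp Require Import ring lra.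

Set Implicit Arguments.
Unset Strict Implicit.
Unset Printing Implicit Defensive.

Import Order.TTheory GRing.Theory Num.Theory.
Import numFieldNormedType.Exports.

Local Open Scope classical_set_scope.
Local Open Scope complex_scope.
Local Open Scope ring_scope.

(* Write S = T + B and P' = |S|, P = |T|. Since S has a bounded inverse G, the
   graph of S*S is the inverse of the graph of the bounded positive operator
   G G*, and the square root of bounded positive operators provides P' and
   Q = P'^(1/2) as inverses of bounded operators. The operators T and S have the
   same domain, hence so do P and P', with comparable graph norms; a Heinz
   inequality then gives D(Q) = D(|T|^(1/2)), which is the domain of Omega. The
   inverse of Q, seen as a map from H to the Banach space of the form, is bounded
   by the closed graph theorem, so that (x, y) |-> Omega(Q^-1 x, Q^-1 y) is a
   bounded form on H, represented by V; V is unique because Q is onto. If T has a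
   bounded inverse then B = 0 is admissible and Omega is nondegenerate, which
   makes V bijective. Existence of |T| and |T|^(1/2), and density of D(T), are
   extracted from D = D(|T|^(1/2)): a junk value of op_sqrt is empty. *)

(** The obstacle is that hyper-solvability speaks of T, which may fail to be invertible, while the
    factorization uses S. Invertibility of S comes from the two conditions on the perturbation,
    applied to the functionals <h, .>, which the embedding of D into H makes bounded for the norm of
    the form. The graph norms of |T| and |S| are comparable because B is bounded: |Tx| and |Sx|
    differ by at most b |x|, while | |A| x | = |A x| holds on D(A*A), a core of A, and passes to
    D(A) by closedness. Absolute values and roots enter only through their defining equations, and a
    positive root of a graph with bounded inverse is recovered from its own inverse. For 0 in the
    resolvent set, solvability of Omega itself follows from that of the perturbed form: a solution u
    of the latter is corrected by T^-1 (B u). *)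

Local Notation Re := complex.Re.
Local Notation Im := complex.Im.

(** * Norms and inner products through the reals *)

Section RealNorm.
Context {R : realType}.

Lemma Re_le (a b : R[i]) : a <= b -> Re a <= Re b.
Proof. by rewrite lecE => /andP[]. Qed.

Lemma ReD (a b : R[i]) : Re (a + b) = Re a + Re b.
Proof. by case: a b => ? ? []. Qed.

Lemma ReN (a : R[i]) : Re (- a) = - Re a.
Proof. by case: a. Qed.

Lemma ReM_real (t : R) (a : R[i]) : Re (t%:C * a) = t * Re a.
Proof. by case: a => a b /=; rewrite mul0r subr0. Qed.

(** Multiplying either conjugate by z gives the squared modulus, and z cancels unless it is 0. *)
Lemma conjE (z : R[i]) : Num.conj z = conjc z.
Proof.
have [->|z0] := eqVneq z 0; first by rewrite conjC0 conjc0.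
by apply: (mulfI z0); rewrite -normCK sqr_normc.
Qed.

(* The norm is valued in R[i], where the order is partial. *)
Definition nrm {U : normedModType R[i]} (x : U) : R := Re `|x|.

Variable U : normedModType R[i].
Implicit Types x y : U.

Lemma nrmE x : `|x| = (nrm x)%:C.
Proof. by rewrite RRe_real // ger0_real. Qed.

Lemma nrm_ge0 x : 0 <= nrm x.
Proof. by rewrite -ler0c -nrmE. Qed.

Lemma nrm0 : nrm (0 : U) = 0.
Proof. by rewrite /nrm normr0. Qed.

Lemma nrm_eq0 x : nrm x = 0 -> x = 0.
Proof. by move=> x0; apply/normr0_eq0; rewrite nrmE x0. Qed.

Lemma nrmN x : nrm (- x) = nrm x.
Proof. by rewrite /nrm normrN. Qed.

Lemma nrmB x y : nrm (x - y) = nrm (y - x).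
Proof. by rewrite /nrm distrC. Qed.

Lemma nrmD x y : nrm (x + y) <= nrm x + nrm y.
Proof. by rewrite -lecR rmorphD /= -!nrmE ler_normD. Qed.

Lemma nrm_tri x y z : nrm (x - z) <= nrm (x - y) + nrm (y - z).
Proof. by rewrite -(subrKA y x) nrmD. Qed.

Lemma nrmZ (t : R) x : nrm (t%:C *: x) = `|t| * nrm x.
Proof.
rewrite /nrm normrZ nrmE -[in RHS]ReM_real.
by rewrite normc_def /= expr0n addr0 sqrtr_sqr.
Qed.

Lemma nrmZi x : nrm ('i%C *: x) = nrm x.
Proof.
by rewrite /nrm normrZ normc_def /= expr0n expr1n add0r sqrtr1 mul1r.
Qed.

Lemma nrm_small x : (forall e, 0 < e -> nrm x < e) -> x = 0.
Proof.
move=> xe; apply: nrm_eq0; apply/eqP; rewrite eq_le nrm_ge0 andbT.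
by apply/ler_addgt0Pr => e e0; rewrite add0r ltW // xe.
Qed.

End RealNorm.

(** * Convergence, completeness and density with real tolerances *)

Section Complete.
Context {R : realType}.

Definition cvgto {U : normedModType R[i]} (u : nat -> U) (l : U) :=
  forall e : R, 0 < e -> exists n, forall m, (n <= m)%N -> nrm (u m - l) < e.

Lemma nrm_complete (U : completeNormedModType R[i]) (u : nat -> U) :
  (forall e : R, 0 < e ->
     exists n, forall m, (n <= m)%N -> nrm (u m - u n) < e) ->
  exists l, cvgto u l.
Proof.
move=> uC.
have : cvg (u @ \oo).
  apply: cauchy_cvg; apply: cauchy_exP => e e0.
  have eE : e = (Re e)%:C by rewrite RRe_real // gtr0_real.
  have [|n un] := uC (Re e); first by rewrite -ltcR -eE.
  exists (u n); rewrite /fmapE /= -ball_normE /ball_.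
  exists n => // m /= /un; rewrite nrmB -ltcR -nrmE => /lt_le_trans; apply.
  by rewrite -eE.
rewrite cvg_ex => -[l ul]; exists l => e e0.
have e0' : 0 < e%:C by rewrite ltcR.
have /cvgrPdist_lt/(_ _ e0') [n _ nul] := ul.
exists n => m nm; rewrite nrmB -ltcR -nrmE; exact: nul.
Qed.

Lemma denseP (U : normedModType R[i]) (S : set U) :
  dense S <-> forall x (e : R), 0 < e -> exists2 y, S y & nrm (x - y) < e.
Proof.
split=> [dS x e e0|dS O [x Ox] oO].
  have e0' : 0 < e%:C by rewrite ltcR.
  have [y []] := dS (ball x e%:C) (ex_intro _ x (ballxx x e0')) (ball_open x e%:C).
  by rewrite -ball_normE /= => xy Sy; exists y => //; rewrite -ltcR -nrmE.
have /nbhs_ballP [e e0 xeO] := open_nbhs_nbhs (conj oO Ox).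
have eE : e = (Re e)%:C by rewrite RRe_real // gtr0_real.
have [|y Sy xy] := dS x (Re e); first by rewrite -ltcR -eE.
exists y; split=> //; apply: xeO.
by rewrite -ball_normE /= nrmE eE ltcR.
Qed.

Lemma cvgto_uniq (U : normedModType R[i]) (u : nat -> U) l l' :
  cvgto u l -> cvgto u l' -> l = l'.
Proof.
move=> ul ul'; apply/eqP; rewrite -subr_eq0; apply/eqP/nrm_small => e e0.
have e2 : 0 < e / 2 by lra.
have [[n un] [n' un']] := (ul _ e2, ul' _ e2).
have := un _ (leq_maxl n n'); have := un' _ (leq_maxr n n').
have := nrm_tri l (u (maxn n n')) l'; rewrite (nrmB l (u _)); lra.
Qed.

End Complete.

Section Linear.
Context {K : nzRingType} {U V : lmodType K} {f : U -> V}.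
Hypothesis lf : linear f.

Lemma linB x y : f (x - y) = f x - f y.
Proof. exact: (zmod_morphism_linear lf). Qed.

Lemma lin0 : f 0 = 0.
Proof. by rewrite -(subrr 0) linB subrr. Qed.

Lemma linN x : f (- x) = - f x.
Proof. by rewrite -sub0r linB lin0 sub0r. Qed.

Lemma linD x y : f (x + y) = f x + f y.
Proof. by rewrite -{1}(opprK y) linB linN opprK. Qed.

Lemma linZ a x : f (a *: x) = a *: f x.
Proof. by rewrite -[a *: x]addr0 lf lin0 addr0. Qed.
End Linear.

Section RealInner.
Context {R : realType} {H : completeNormedModType R[i]}.
Variable ip : {dot H for Num.conj}.
Hypothesis hilb : hilbert ip.
Implicit Types x y z : H.

Definition re_ip x y : R := Re (ip x y).

Lemma ipC x y : ip x y = conjc (ip y x).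
Proof. rewrite hermC expr0 mul1r; exact: conjE. Qed.

Lemma ipDl x y z : ip (x + y) z = ip x z + ip y z.
Proof. by rewrite linearDl. Qed.
Lemma ipDr x y z : ip z (x + y) = ip z x + ip z y.
Proof. by rewrite linearDr. Qed.
Lemma ipNl x z : ip (- x) z = - ip x z.
Proof. by rewrite linearNl. Qed.
Lemma ipNr x z : ip z (- x) = - ip z x.
Proof. by rewrite linearNr. Qed.
Lemma ipZl a x z : ip (a *: x) z = a * ip x z.
Proof. by rewrite linearZl_LR. Qed.
Lemma ipZr a x z : ip z (a *: x) = conjc a * ip z x.
Proof. by rewrite linearZr /=; congr (_ * _); exact: conjE. Qed.
Lemma ip0l z : ip 0 z = 0.
Proof. by rewrite linear0l. Qed.
Lemma ip0r z : ip z 0 = 0.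
Proof. by rewrite linear0r. Qed.

Lemma ripC x y : re_ip x y = re_ip y x.
Proof. by rewrite /re_ip ipC; case: (ip y x). Qed.
Lemma ripDl x y z : re_ip (x + y) z = re_ip x z + re_ip y z.
Proof. by rewrite /re_ip ipDl ReD. Qed.
Lemma ripNl x z : re_ip (- x) z = - re_ip x z.
Proof. by rewrite /re_ip ipNl ReN. Qed.
Lemma ripZl (t : R) x z : re_ip (t%:C *: x) z = t * re_ip x z.
Proof. by rewrite /re_ip ipZl ReM_real. Qed.
Lemma rip0l z : re_ip 0 z = 0.
Proof. by rewrite /re_ip ip0l. Qed.
Lemma ripDr x y z : re_ip z (x + y) = re_ip z x + re_ip z y.
Proof. by rewrite ripC ripDl !(ripC z). Qed.
Lemma ripNr x z : re_ip z (- x) = - re_ip z x.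
Proof. by rewrite ripC ripNl (ripC z). Qed.
Lemma ripZr (t : R) x z : re_ip z (t%:C *: x) = t * re_ip z x.
Proof. by rewrite ripC ripZl (ripC z). Qed.
Lemma rip0r z : re_ip z 0 = 0.
Proof. by rewrite ripC rip0l. Qed.

Definition ripE := (ripDl, ripDr, ripNl, ripNr, ripZl, ripZr, rip0l, rip0r).

Lemma nrm2 x : nrm x ^+ 2 = re_ip x x.
Proof. by rewrite /re_ip -hilb nrmE -rmorphXn. Qed.

Lemma rip_i x y : re_ip x ('i%C *: y) = Im (ip x y).
Proof. by rewrite /re_ip ipZr; case: (ip x y) => a b /=; rewrite mul0r sub0r mulN1r opprK. Qed.

(** Estimates take place in the real Hilbert space underlying H; testing against iy as well recovers
    complex identities. *)
Lemma ip_ext x y u v : re_ip x y = re_ip u v ->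
  re_ip x ('i%C *: y) = re_ip u ('i%C *: v) -> ip x y = ip u v.
Proof.
by rewrite !rip_i /re_ip; case: (ip x y) (ip u v) => ? ? [? ?] /= -> ->.
Qed.

Lemma rip_inj x z : (forall y, re_ip x y = re_ip z y) -> x = z.
Proof.
move=> xz; apply/eqP; rewrite -subr_eq0; apply/eqP/nrm_eq0.
apply/eqP; rewrite -sqrf_eq0 nrm2 ripDl ripNl xz; apply/eqP; ring.
Qed.

Lemma ip_inj x z : (forall y, ip x y = ip z y) -> x = z.
Proof. by move=> xz; apply: rip_inj => y; rewrite /re_ip xz. Qed.

Lemma cauchy_schwarz x y : `|re_ip x y| <= nrm x * nrm y.
Proof.
rewrite -ler_sqr ?nnegrE ?mulr_ge0 ?nrm_ge0 // exprMn real_normK ?num_real //.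
have [y0|y0] := eqVneq (nrm y) 0.
  by rewrite (nrm_eq0 y0) rip0r nrm0 expr0n mulr0.
(* With r = [re_ip x y], this square expands to |y|^2 (|x|^2 |y|^2 - r^2). *)
have : 0 <= nrm ((nrm y ^+ 2)%:C *: x - (re_ip x y)%:C *: y) ^+ 2 by exact: sqr_ge0.
rewrite nrm2 !ripE -!nrm2 (ripC y x) => h.
have y2 : 0 < nrm y ^+ 2 by rewrite exprn_gt0 // lt_def y0 nrm_ge0.
rewrite -(ler_pM2l y2); nra.
Qed.

Lemma rip_le x y : re_ip x y <= nrm x * nrm y.
Proof. exact: le_trans (ler_norm _) (cauchy_schwarz x y). Qed.

End RealInner.

Section Limits.
Context {R : realType}.

Lemma sqr_lt_imp (x e : R) : 0 < e -> x ^+ 2 < e ^+ 2 -> x < e.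
Proof. by move=> e0; rewrite ltNge => h; rewrite ltNge; apply: contra h; nra. Qed.

Lemma sqr_le_imp (x e : R) : 0 <= e -> x ^+ 2 <= e ^+ 2 -> x <= e.
Proof. by move=> e0; rewrite leNgt => h; rewrite leNgt; apply: contra h; nra. Qed.

Lemma inv_nat_lt (e : R) : 0 < e ->
  exists n, forall m, (n <= m)%N -> m.+1%:R^-1 < e.
Proof.
move=> e0; exists (Num.truncn e^-1) => m nm.
rewrite -ltf_pV2 ?posrE ?invr_gt0 // invrK.
apply: lt_le_trans (truncnS_gt _) _.
by rewrite ler_nat ltnS.
Qed.

Variable U : normedModType R[i].
Implicit Types (u : nat -> U) (l : U).

Lemma cvgto_inv u l : (forall n, nrm (u n - l) < n.+1%:R^-1) -> cvgto u l.
Proof.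
move=> ul e /inv_nat_lt [n en]; exists n => m nm.
exact: lt_trans (ul m) (en m nm).
Qed.

Lemma cvgto_nrm2 u l : cvgto u l -> forall e : R, 0 < e ->
  exists n, forall m, (n <= m)%N -> `|nrm (u m) ^+ 2 - nrm l ^+ 2| < e.
Proof.
(* If |u_m - l| < d <= 1, then |u_m| + |l| <= 2 |l| + 1, so the squares differ by at most d (2 |l| +
   1) <= e. *)
move=> ul e e0; set d := Num.min 1 (e / (2 * nrm l + 1)).
have l0 := nrm_ge0 l.
have de : d * (2 * nrm l + 1) <= e.
  by rewrite -ler_pdivlMr ?ge_min ?lexx ?orbT //; lra.
have d0 : 0 < d by rewrite lt_min ltr01 divr_gt0 //; lra.
have d1 : d <= 1 by rewrite ge_min lexx.
have [n un] := ul _ d0; exists n => m /un uml.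
have := nrmD (u m - l) l; rewrite subrK => h1.
have := nrmD (l - u m) (u m); rewrite subrK (nrmB l) => h2.
have := nrm_ge0 (u m); have := nrm_ge0 (u m - l).
move: (nrm (u m)) (nrm (u m - l)) (nrm l) => p q r in uml h1 h2 de l0 *.
move=> q0 p0; rewrite ltr_norml; apply/andP; split; nra.
Qed.

End Limits.

(** * Closed linear graphs *)

Section Graphs.
Context {R : realType} {H : completeNormedModType R[i]}.
Implicit Types (A C : set (H * H)) (x y z : H).

Definition lin_graph A := A (0, 0) /\
  forall c x y x' y', A (x, y) -> A (x', y') -> A (c *: x + x', c *: y + y').

(** For a linear graph, single-valuedness is decided at 0. *)
Definition functional_graph A := forall y, A (0, y) -> y = 0.

Definition closure_graph A : set (H * H) :=
  [set p | forall e : R, 0 < e ->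
    exists x y, [/\ A (x, y), nrm (p.1 - x) < e & nrm (p.2 - y) < e]].

Definition closed_graph A := closure_graph A `<=` A.

Lemma lin_graphB A x y x' y' :
  lin_graph A -> A (x, y) -> A (x', y') -> A (x - x', y - y').
Proof.
move=> [_ lA] Axy Axy'; have := lA (-1) _ _ _ _ Axy' Axy.
by rewrite !scaleN1r ![- _ + _]addrC.
Qed.

Lemma lin_graphD A x y x' y' :
  lin_graph A -> A (x, y) -> A (x', y') -> A (x + x', y + y').
Proof.
by move=> [_ lA] Axy Axy'; have := lA 1 _ _ _ _ Axy Axy'; rewrite !scale1r.
Qed.

Lemma lin_graphZ A c x y : lin_graph A -> A (x, y) -> A (c *: x, c *: y).
Proof. by move=> [A0 lA] Axy; have := lA c _ _ _ _ Axy A0; rewrite !addr0. Qed.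

Lemma functional_graphP A x y y' : lin_graph A -> functional_graph A ->
  A (x, y) -> A (x, y') -> y = y'.
Proof.
move=> lA fA Axy Axy'; apply/eqP; rewrite -subr_eq0; apply/eqP/fA.
by have := lin_graphB lA Axy Axy'; rewrite subrr.
Qed.

Lemma sub_closure_graph A : A `<=` closure_graph A.
Proof.
by move=> [x y] Axy e e0; exists x, y; rewrite !subrr nrm0; split.
Qed.

Lemma closed_closure_graph A : closed_graph (closure_graph A).
Proof.
move=> [x y] /= cA e e0; have e2 : 0 < e / 2 by lra.
have [x1 [y1 [/(_ _ e2) /= [x2 [y2 [Axy xx yy]]] xx1 yy1]]] := cA _ e2.
have := nrm_tri x x1 x2; have := nrm_tri y y1 y2.
by exists x2, y2; split=> //; lra.
Qed.

Lemma nrmZc (c : R[i]) x : nrm (c *: x) = Re `|c| * nrm x.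
Proof.
by rewrite {1}/nrm normrZ -ReM_real RRe_real // ger0_real.
Qed.

Lemma lin_closure_graph A : lin_graph A -> lin_graph (closure_graph A).
Proof.
move=> lA; split; first exact: sub_closure_graph lA.1.
move=> c x y x' y' cA cA' e e0.
have c0 : 0 <= Re `|c| by rewrite -ler0c RRe_real // ger0_real.
have e2 : 0 < e / (Re `|c| + 1) by rewrite divr_gt0 //; lra.
have eE : e = e / (Re `|c| + 1) * (Re `|c| + 1).
  by rewrite divfK //; lra.
have [x1 [y1 [/= A1 xx1 yy1]]] := cA _ e2.
have [x2 [y2 [/= A2 xx2 yy2]]] := cA' _ e2.
exists (c *: x1 + x2), (c *: y1 + y2).
have dE (a b a' b' : H) : c *: a + a' - (c *: b + b') = c *: (a - b) + (a' - b').
  by rewrite opprD addrACA -scalerBr.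
split=> /=; first exact: lA.2.
  rewrite dE; have := nrmD (c *: (x - x1)) (x' - x2); rewrite nrmZc.
  nra.
rewrite dE; have := nrmD (c *: (y - y1)) (y' - y2); rewrite nrmZc.
nra.
Qed.

Lemma closed_graph_cvgto A (u v : nat -> H) x y : closed_graph A ->
  (forall n, A (u n, v n)) -> cvgto u x -> cvgto v y -> A (x, y).
Proof.
move=> clA Auv ux vy; apply: clA => e e0 /=.
have [[n un] [m vm]] := (ux _ e0, vy _ e0).
exists (u (maxn n m)), (v (maxn n m)); rewrite nrmB (nrmB y).
by split=> //; [apply: un; exact: leq_maxl | apply: vm; exact: leq_maxr].
Qed.

End Graphs.

(** * Orthogonal projection onto closed linear graphs *)

Section Projection.
Context {R : realType} {H : completeNormedModType R[i]}.
Variable ip : {dot H for Num.conj}.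
Hypothesis hilb : hilbert ip.
Implicit Types (A C : set (H * H)) (x y z h k : H).
Local Notation rip := (re_ip ip).

(* Minimize |h - x|^2 + |k - y|^2 over A: by the parallelogram law a minimizing
   sequence is Cauchy. *)
Lemma graph_projection A h k : lin_graph A -> closed_graph A ->
  exists x y, A (x, y) /\
    forall a b, A (a, b) -> ip (h - x) a + ip (k - y) b = 0.
Proof.
move=> lA clA.
pose dist (p : H * H) := nrm (h - p.1) ^+ 2 + nrm (k - p.2) ^+ 2.
have dist0 p : 0 <= dist p by rewrite addr_ge0 // sqr_ge0.
pose d := inf (dist @` A).
have dP p : A p -> d <= dist p.
  move=> Ap; apply: ge_inf; last by exists p.
  by exists 0 => _ [q _ <-].
have infS : has_inf (dist @` A).
  split; first by exists (dist (0, 0)), (0, 0) => //; exact: lA.1.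
  by exists 0 => _ [q _ <-].
have [p pP] : {p : nat -> H * H &
    forall n, A (p n) /\ dist (p n) < d + n.+1%:R^-1}.
  apply: (@choice _ _ (fun n q => A q /\ dist q < d + n.+1%:R^-1)) => n.
  have n0 : 0 < n.+1%:R^-1 :> R by rewrite invr_gt0 ltr0n.
  have [_ [q Aq <-] qd] := inf_adherent n0 infS.
  by exists q.
have midE (a b c : H) : nrm (b - c) ^+ 2 =
    2 * nrm (a - b) ^+ 2 + 2 * nrm (a - c) ^+ 2
    - 4 * nrm (a - (2^-1)%:C *: (b + c)) ^+ 2.
  rewrite !(nrm2 hilb) !ripE (ripC ip c b) (ripC ip c a) (ripC ip b a).
  by field.
have diff n m : (n <= m)%N ->
    nrm ((p m).1 - (p n).1) ^+ 2 + nrm ((p m).2 - (p n).2) ^+ 2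
    <= 4 * n.+1%:R^-1.
  move=> nm; have [[An dn] [Am dm]] := (pP n, pP m).
  have nmV : m.+1%:R^-1 <= n.+1%:R^-1 :> R.
    by rewrite lef_pV2 ?posrE ?ltr0n // ler_nat.
  rewrite (midE h (p m).1) (midE k (p m).2).
  set q := ((2^-1)%:C *: ((p m).1 + (p n).1), (2^-1)%:C *: ((p m).2 + (p n).2)).
  have Aq : A q.
    apply: lin_graphZ => //; apply: lin_graphD => //.
    - by move: Am; case: (p m).
    - by move: An; case: (p n).
  have := dP _ Aq; move: dn dm nmV; rewrite /dist /q /=; clear -R.
  move: (n.+1%:R^-1) (m.+1%:R^-1) => a b; lra.
have cau (f : nat -> H) : (forall n m, (n <= m)%N ->
    nrm (f m - f n) ^+ 2 <= 4 * n.+1%:R^-1) -> exists l, cvgto f l.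
  move=> fC; apply: nrm_complete => e e0.
  have e2 : 0 < e ^+ 2 / 4 by rewrite divr_gt0 ?exprn_gt0.
  have [n nV] := inv_nat_lt e2; exists n => m nm.
  apply: sqr_lt_imp => //; have := fC n m nm; have := nV n (leqnn n).
  move: (n.+1%:R^-1) => a; lra.
have [|x px] := cau (fun n => (p n).1).
  move=> n m /diff /=; have := sqr_ge0 (nrm ((p m).2 - (p n).2)); move: (n.+1%:R^-1) => b; lra.
have [|y py] := cau (fun n => (p n).2).
  move=> n m /diff /=; have := sqr_ge0 (nrm ((p m).1 - (p n).1)); move: (n.+1%:R^-1) => b; lra.
exists x, y; split.
  apply: closed_graph_cvgto clA _ px py => n.
  by have [+ _] := pP n; case: (p n).
have orth a b : A (a, b) -> rip (h - x) a + rip (k - y) b = 0.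
  move=> Aab; set s := _ + _; set q := nrm a ^+ 2 + nrm b ^+ 2.
  have q0 : 0 <= q by rewrite addr_ge0 // sqr_ge0.
  (* Moving the almost minimal [p n] by t (a, b) cannot lower [dist] by more than 1/(n+1). Replacing
     [p n] by its limit costs 2 |t| (|a| + |b|) e/M, and M makes both errors add up to e. *)
  have st t : 2 * t * s <= t ^+ 2 * q.
    apply/ler_addgt0Pr => e e0.
    set M := 1 + 2 * `|t| * (nrm a + nrm b).
    have a0 := nrm_ge0 a; have b0 := nrm_ge0 b; have t0 := normr_ge0 t.
    have M0 : 0 < M by rewrite /M; nra.
    have eM0 : 0 < e / M by rewrite divr_gt0.
    have eME : e = e / M * M by rewrite divfK // gt_eqF.
    have [n1 n1P] := px _ eM0; have [n2 n2P] := py _ eM0.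
    have [n3 n3P] := inv_nat_lt eM0.
    set n := maxn n1 (maxn n2 n3).
    have {n1P} h1 := n1P n (leq_maxl _ _).
    have {n2P} h2 := n2P n (leq_trans (leq_maxl _ _) (leq_maxr _ _)).
    have {n3P} h3 := n3P n (leq_trans (leq_maxr _ _) (leq_maxr _ _)).
    have [An dn] := pP n.
    have Aq : A ((p n).1 + t%:C *: a, (p n).2 + t%:C *: b).
      apply: lin_graphD => //; last exact: lin_graphZ.
      by move: An; case: (p n).
    have := dP _ Aq; rewrite /dist /=.
    have expand (c u v : H) : nrm (c - (u + t%:C *: v)) ^+ 2 =
        nrm (c - u) ^+ 2 - 2 * t * rip (c - u) v + t ^+ 2 * nrm v ^+ 2.
      rewrite !(nrm2 hilb) !ripE (ripC ip v c) (ripC ip v u) (ripC ip u c).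
      by ring.
    rewrite !expand => hd.
    have sub (c u v w : H) : rip (c - u) v = rip (c - w) v - rip (u - w) v.
      by rewrite !ripE; ring.
    rewrite (sub h _ a x) (sub k _ b y) in hd.
    have ta : `|t * rip ((p n).1 - x) a| <= `|t| * (e / M * nrm a).
      rewrite normrM ler_wpM2l //; apply: le_trans (cauchy_schwarz hilb _ _) _.
      by rewrite ler_wpM2r // ltW.
    have tb : `|t * rip ((p n).2 - y) b| <= `|t| * (e / M * nrm b).
      rewrite normrM ler_wpM2l //; apply: le_trans (cauchy_schwarz hilb _ _) _.
      by rewrite ler_wpM2r // ltW.
    move: dn; rewrite /dist => dn.
    have {}ta := le_trans (ler_norm _) ta; have {}tb := le_trans (ler_norm _) tb.
    rewrite eME /M /q /s; clear -ta tb h3 dn hd.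
    move: (n.+1%:R^-1) (e / M) ta tb h3 dn hd => nV eM ta tb h3 dn hd.
    lra.
  have q1 : q + 1 != 0 by lra.
  (* At t = s / (q + 1) the bound reads 2 (q + 1) t^2 <= q t^2, which forces t = 0. *)
  have := st (s / (q + 1)).
  have -> : 2 * (s / (q + 1)) * s = (s / (q + 1)) ^+ 2 * (2 * (q + 1)) by field.
  have sE : s = s / (q + 1) * (q + 1) by rewrite divfK.
  move=> h1; suff t0 : s / (q + 1) = 0 by rewrite sE t0 mul0r.
  have := sqr_ge0 (s / (q + 1)).
  move: h1; move: (s / (q + 1)) => t h1 h2.
  by apply/eqP; rewrite -sqrf_eq0; apply/eqP; nra.
(* The imaginary part vanishes because A also contains i (a, b). *)
move=> a b Aab; have h1 := orth _ _ Aab.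
have := orth _ _ (lin_graphZ 'i%C lA Aab); rewrite !rip_i.
move: h1; rewrite /re_ip.
case: (ip (h - x) a) (ip (k - y) b) => u v [u' v'] /= uu vv.
by apply/eqP; rewrite eq_complex /= uu vv eqxx.
Qed.

End Projection.

(** * Adjoints, cores and Riesz representation *)

Section Adjoints.
Context {R : realType} {H : completeNormedModType R[i]}.
Variable ip : {dot H for Num.conj}.
Hypothesis hilb : hilbert ip.
Implicit Types (A C : set (H * H)) (x y z h k : H).
Local Notation rip := (re_ip ip).

Lemma dense_orth (S : set H) y :
  dense S -> (forall x, S x -> ip x y = 0) -> y = 0.
Proof.
move=> /denseP dS Sy; apply: nrm_eq0; apply/eqP; apply: contraT => ny0.
have y0 : 0 < nrm y by rewrite lt_def ny0 nrm_ge0.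
have [|x /Sy xy yx] := dS y (nrm y / 2); first by lra.
have h1 : rip x y = 0 by rewrite /re_ip xy.
have := rip_le hilb (y - x) y; rewrite !ripE h1 -(nrm2 hilb); nra.
Qed.

Lemma rip_closure x w y z :
  (forall e : R, 0 < e -> exists y' z',
     [/\ rip w y' = rip x z', nrm (y - y') < e & nrm (z - z') < e]) ->
  rip w y = rip x z.
Proof.
move=> cl; apply/eqP; rewrite -subr_eq0 -normr_le0; apply/ler_addgt0Pr => e e0.
have w0 := nrm_ge0 w; have x0 := nrm_ge0 x.
have M0 : 0 < nrm w + nrm x + 1 by lra.
have d0 : 0 < e / (nrm w + nrm x + 1) by rewrite divr_gt0.
have [y' [z' [yz yy zz]]] := cl _ d0.
have -> : rip w y - rip x z = rip w (y - y') - rip x (z - z').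
  by rewrite !ripE yz; ring.
apply: le_trans (ler_normB _ _) _.
have h1 := cauchy_schwarz hilb w (y - y').
have h2 := cauchy_schwarz hilb x (z - z').
rewrite add0r; apply: le_trans (lerD h1 h2) _.
have eE : e = e / (nrm w + nrm x + 1) * (nrm w + nrm x + 1).
  by rewrite divfK // gt_eqF.
rewrite [leRHS]eE; move: (e / _) d0 yy zz => d d0 yy zz; nra.
Qed.

Lemma ip_closure x w y z :
  (forall e : R, 0 < e -> exists y' z',
     [/\ ip w y' = ip x z', nrm (y - y') < e & nrm (z - z') < e]) ->
  ip w y = ip x z.
Proof.
move=> cl; apply: ip_ext; apply: rip_closure => e /cl [y' [z' [yz yy zz]]].
  by exists y', z'; rewrite /re_ip yz.
exists ('i%C *: y'), ('i%C *: z'); rewrite -!scalerBr !nrmZi; split=> //.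
by rewrite !rip_i yz.
Qed.

Lemma ip_cvgto (u v : nat -> H) x y l k : cvgto u l -> cvgto v k ->
  (forall n, ip (u n) y = ip x (v n)) -> ip l y = ip x k.
Proof.
move=> ul vk uv; have main (y1 : H) (v1 : nat -> H) k1 : cvgto v1 k1 ->
    (forall n, rip (u n) y1 = rip x (v1 n)) -> rip l y1 = rip x k1.
  move=> vk1 uv1; rewrite ripC; apply: rip_closure => e e0.
  have [[n1 h1] [n2 h2]] := (ul _ e0, vk1 _ e0).
  have {}h1 := h1 _ (leq_maxl n1 n2); have {}h2 := h2 _ (leq_maxr n1 n2).
  exists (u (maxn n1 n2)), (v1 (maxn n1 n2)).
  by rewrite nrmB (nrmB k1) ripC uv1.
apply: ip_ext; first by apply: main vk _ => n; rewrite /re_ip uv.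
apply: (main _ (fun n => 'i%C *: v n)) => [e e0|n].
  have [n nP] := vk _ e0; exists n => m /nP.
  by rewrite -scalerBr nrmZi.
by rewrite !rip_i uv.
Qed.

Lemma closed_adjoint A : closed_graph (op_adjoint ip A).
Proof.
move=> [y z] cl x w Axw /=; apply: ip_closure => e /cl [y' [z' [adj yy zz]]].
by exists y', z'; split=> //; exact: adj.
Qed.

Lemma lin_adjoint A : lin_graph (op_adjoint ip A).
Proof.
split=> [x w _|c y z y' z' adj adj' x w Axw] /=; first by rewrite !ip0r.
by rewrite !ipDr !ipZr; congr (_ * _ + _); [exact: adj | exact: adj'].
Qed.

Lemma functional_adjoint A :
  dense (op_dom A) -> functional_graph (op_adjoint ip A).
Proof.
move=> dA y adj; apply: dense_orth dA _ => x [w Axw].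
by rewrite -(adj _ _ Axw) /= ip0r.
Qed.

(* Project (h, 0) orthogonally on A. *)
Lemma add_adjoint_comp_onto A h : lin_graph A -> closed_graph A ->
  exists x y z, [/\ A (x, y), op_adjoint ip A (y, z) & h = x + z].
Proof.
move=> lA cA; have [x [y [Axy orth]]] := graph_projection hilb h 0 lA cA.
exists x, y, (h - x); split; rewrite ?subrKC // => a b Aab /=.
have := orth _ _ Aab; rewrite sub0r ipNl => /eqP; rewrite subr_eq0 => /eqP.
by rewrite (ipC ip b) (ipC ip a) => ->.
Qed.

(** D(A*A) is a core of A: if (u, v) in A is orthogonal to the restriction of A to D(A*A), then <u,
    x1 + A*A x1> = 0 for every x1 in D(A*A). As 1 + A*A is onto, u = 0, and v = 0 by
    single-valuedness. *)
Lemma adjoint_comp_core A x y :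
  lin_graph A -> closed_graph A -> functional_graph A -> A (x, y) ->
  forall e : R, 0 < e -> exists x' y' z',
    [/\ A (x', y'), op_adjoint ip A (y', z'), nrm (x - x') < e
      & nrm (y - y') < e].
Proof.
move=> lA cA fA Axy.
set C0 : set (H * H) := [set p | A p /\ exists z, op_adjoint ip A (p.2, z)].
have lC0 : lin_graph C0.
  split=> [|c a b a' b' [Aab [z bz]] [Aab' [z' bz']]].
    by split; [exact: lA.1 | exists 0; exact: (lin_adjoint A).1].
  split; first exact: lA.2.
  by exists (c *: z + z'); exact: (lin_adjoint A).2.
set C := closure_graph C0.
have lC : lin_graph C by exact: lin_closure_graph.
have CA : C `<=` A.
  move=> p Cp; apply: cA => e /Cp [a [b [[Aab _] pa pb]]].
  by exists a, b.
have [x0 [y0 [Cxy orth]]] :=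
  graph_projection hilb x y lC (@closed_closure_graph _ _ C0).
have Auv : A (x - x0, y - y0) by apply: lin_graphB => //; exact: CA.
have [x1 [y1 [z1 [A1 adj1 uE]]]] := add_adjoint_comp_onto (x - x0) lA cA.
have u0 : x - x0 = 0.
  have C1 : C (x1, y1) by apply: sub_closure_graph; split=> //; exists z1.
  have := orth _ _ C1; rewrite (adj1 _ _ Auv) /= -ipDr -uE => uu.
  by apply/normr0_eq0/eqP; rewrite -sqrf_eq0 hilb uu.
have v0 : y - y0 = 0 by apply: fA; rewrite -u0.
move=> e e0; have [x' [y' [[A' [z' adj']] xx yy]]] := Cxy _ e0.
exists x', y', z'; split=> //.
- by rewrite (subr0_eq u0).
- by rewrite (subr0_eq v0).
Qed.

(** A bound by the graph norm of A on the core D(A*A) makes the values of C along a core sequence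
    Cauchy; closedness of C then puts the limit point in its domain, with the same bound. *)
Lemma core_extension A C (a m : R) :
  lin_graph A -> closed_graph A -> functional_graph A ->
  lin_graph C -> closed_graph C -> functional_graph C -> 0 <= a -> 0 <= m ->
  (forall x y z, A (x, y) -> op_adjoint ip A (y, z) ->
    exists2 w, C (x, w) & nrm w ^+ 2 <= a * nrm x ^+ 2 + m * nrm y ^+ 2) ->
  forall x y, A (x, y) ->
    exists2 w, C (x, w) & nrm w ^+ 2 <= a * nrm x ^+ 2 + m * nrm y ^+ 2.
Proof.
move=> lA cA fA lC cC fC a0 m0 bnd x y Axy.
have core := adjoint_comp_core lA cA fA Axy.
pose P (n : nat) (q : H * H * H) := [/\ A (q.1.1, q.1.2),
  exists z, op_adjoint ip A (q.1.2, z), C (q.1.1, q.2)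
  & nrm (q.1.1 - x) < n.+1%:R^-1 /\ nrm (q.1.2 - y) < n.+1%:R^-1].
have [s sP] : {s : nat -> H * H * H & forall n, P n (s n)}.
  apply: (@choice _ _ P) => n.
  have n0 : 0 < n.+1%:R^-1 :> R by rewrite invr_gt0 ltr0n.
  have [x' [y' [z' [A' adj xx yy]]]] := core _ n0.
  have [w Cw _] := bnd _ _ _ A' adj.
  exists (x', y', w); split=> //=; first by exists z'.
  by rewrite nrmB (nrmB y').
have ux : cvgto (fun n => (s n).1.1) x by apply: cvgto_inv => n; case: (sP n) => _ _ _ [].
have uy : cvgto (fun n => (s n).1.2) y by apply: cvgto_inv => n; case: (sP n) => _ _ _ [].
have diff (n k : nat) : nrm ((s n).2 - (s k).2) ^+ 2 <=
    a * nrm ((s n).1.1 - (s k).1.1) ^+ 2 + m * nrm ((s n).1.2 - (s k).1.2) ^+ 2.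
  have [An [zn adjn] Cn _] := sP n; have [Ak [zk adjk] Ck _] := sP k.
  have [w Cw] := bnd _ _ _ (lin_graphB lA An Ak)
    (lin_graphB (lin_adjoint A) adjn adjk).
  by rewrite (functional_graphP lC fC Cw (lin_graphB lC Cn Ck)).
have [l ul] : exists l, cvgto (fun n => (s n).2) l.
  apply: nrm_complete => e e0.
  have M0 : 0 < a + m + 1 by lra.
  have e1 : 0 < Num.min 1 (e ^+ 2 / (4 * (a + m + 1))).
    by rewrite lt_min ltr01 divr_gt0 ?exprn_gt0 // mulr_gt0.
  have [n nV] := inv_nat_lt e1; exists n => k nk.
  apply: sqr_lt_imp => //; apply: le_lt_trans (diff k n) _.
  have := nV n (leqnn n); have := nV k nk; rewrite !lt_min.
  move=> /andP[k1 kM] /andP[n1 nM].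
  have [_ _ _ [xk yk]] := sP k; have [_ _ _ [xn yn]] := sP n.
  have hx := nrm_tri (s k).1.1 x (s n).1.1.
  have hy := nrm_tri (s k).1.2 y (s n).1.2.
  rewrite (nrmB x) in hx; rewrite (nrmB y) in hy.
  have px := nrm_ge0 ((s k).1.1 - (s n).1.1).
  have py := nrm_ge0 ((s k).1.2 - (s n).1.2).
  set c := e ^+ 2 / _ in kM nM.
  have eE : e ^+ 2 = c * (4 * (a + m + 1)) by rewrite /c divfK // gt_eqF // mulr_gt0.
  have c0 : 0 < c by rewrite /c divr_gt0 ?exprn_gt0 // mulr_gt0.
  (* A distance p below both 2 and 2c has p^2 <= 4c; hence the [min] with 1 in the tolerance and the
     4 in the denominator of c. *)
  have aux (p q1 q2 r1 r2 : R) : 0 <= p -> p <= q1 + q2 -> q1 < r1 -> q2 < r2 ->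
      r1 < 1 -> r2 < 1 -> r1 < c -> r2 < c -> p ^+ 2 <= 4 * c.
    move=> *; have : p <= 2 by lra.
    have : p <= 2 * c by lra.
    nra.
  have ex := aux _ _ _ _ _ px hx xk xn k1 n1 kM nM.
  have ey := aux _ _ _ _ _ py hy yk yn k1 n1 kM nM.
  rewrite eE; nra.
exists l; first by apply: closed_graph_cvgto cC _ ux ul => n; case: (sP n).
apply/ler_addgt0Pr => e e0.
have M0 : 0 < a + m + 1 by lra.
have e1 : 0 < e / (a + m + 1) by rewrite divr_gt0.
have eE : e = e / (a + m + 1) * (a + m + 1) by rewrite divfK // gt_eqF.
have [n1 h1] := cvgto_nrm2 ux e1; have [n2 h2] := cvgto_nrm2 uy e1.
have [n3 h3] := cvgto_nrm2 ul e1.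
set n := maxn n1 (maxn n2 n3).
have {}h1 := h1 n (leq_maxl _ _).
have {}h2 := h2 n (leq_trans (leq_maxl _ _) (leq_maxr _ _)).
have {}h3 := h3 n (leq_trans (leq_maxr _ _) (leq_maxr _ _)).
have [An [z adj] Cn _] := sP n; have [w Cw] := bnd _ _ _ An adj.
rewrite (functional_graphP lC fC Cw Cn).
rewrite eE; move: (e / _) e1 h1 h2 h3 => d d0; rewrite !ltr_norml.
move=> /andP[_ h1] /andP[_ h2] /andP[h3 _]; nra.
Qed.

(* |T| and T have the same domain, and | |T| x | = | T x |. *)
Lemma same_square_extension A C :
  lin_graph A -> closed_graph A -> functional_graph A ->
  lin_graph C -> closed_graph C -> functional_graph C ->
  op_comp (op_adjoint ip A) A `<=` op_comp (op_adjoint ip C) C ->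
  forall x y, A (x, y) -> exists2 w, C (x, w) & nrm w <= nrm y.
Proof.
move=> lA cA fA lC cC fC AC x y Axy.
have bnd x' y' z' : A (x', y') -> op_adjoint ip A (y', z') ->
    exists2 w, C (x', w) & nrm w ^+ 2 <= 0 * nrm x' ^+ 2 + 1 * nrm y' ^+ 2.
  move=> A' adj; have [w [Cw adjw]] : op_comp (op_adjoint ip C) C (x', z').
    by apply: AC; exists y'.
  exists w => //; rewrite mul0r add0r mul1r !(nrm2 hilb) /re_ip.
  by rewrite (adj _ _ A') (adjw _ _ Cw).
have [w Cw bw] := core_extension lA cA fA lC cC fC (lexx 0) ler01 bnd Axy.
exists w => //; apply: sqr_le_imp; rewrite ?nrm_ge0 //.
by rewrite mul0r add0r mul1r in bw.
Qed.

(** The kernel of f, coded as the graph ker f x {0}, admits projections. If w is the component of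
    some x0 outside ker f that is orthogonal to ker f, then y - a w lies in ker f for a suitable a,
    which gives z = (f w / <w, w>) w. A bound on the real part suffices, since Re f(ix) = Im
    f(x). *)
Lemma riesz (f : H -> R[i]) (c : R) :
  (forall a x y, f (a *: x + y) = conjc a * f x + f y) ->
  (forall x, `|Re (f x)| <= c * nrm x) ->
  exists z, forall y, f y = ip z y.
Proof.
move=> lf bf.
have fD x y : f (x + y) = f x + f y.
  by rewrite -[x]scale1r lf conjc1 mul1r scale1r.
have f0 : f 0 = 0 by apply: (addrI (f 0)); rewrite -fD !addr0.
have fZ a x : f (a *: x) = conjc a * f x by rewrite -[a *: x]addr0 lf f0 addr0.
have fN x : f (- x) = - f x.
  by apply/eqP; rewrite -addr_eq0 -fD addNr f0.
set A : set (H * H) := [set p | f p.1 = 0 /\ p.2 = 0].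
have lA : lin_graph A.
  split=> // a x y x' y' [/= fx ->] [/= fx' ->].
  by split=> /=; rewrite ?lf ?fx ?fx' ?scaler0 ?mulr0 addr0.
have cl_re x : (forall e : R, 0 < e -> exists x', f x' = 0 /\ nrm (x - x') < e) ->
    Re (f x) = 0.
  move=> cl; apply/eqP; rewrite -normr_le0; apply/ler_addgt0Pr => e e0.
  have M0 : 0 < `|c| + 1 by have := normr_ge0 c; lra.
  have [|x' [fx' xx]] := cl (e / (`|c| + 1)); first by rewrite divr_gt0.
  have := bf (x - x'); rewrite fD fN fx' subr0 add0r => /le_trans; apply.
  rewrite -[leRHS](divfK (lt0r_neq0 M0)); have := ler_norm c.
  have := nrm_ge0 (x - x'); have := normr_ge0 c; nra.
have cA : closed_graph A.
  move=> [x y] cl; split=> /=.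
    have cx e : 0 < e -> exists x', f x' = 0 /\ nrm (x - x') < e.
      by move=> /cl [x' [y' [[/= fx' _] xx _]]]; exists x'.
    have h1 := cl_re _ cx.
    have : Re (f ('i%C *: x)) = 0.
      apply: cl_re => e /cx [x' [fx' xx]]; exists ('i%C *: x').
      by rewrite fZ fx' mulr0 -scalerBr nrmZi.
    rewrite fZ; case: (f x) h1 => u v /= -> /=; rewrite mul0r sub0r mulN1r opprK.
    by move=> ->.
  apply: nrm_small => e /cl [x' [y' [[/= _ y'0] _]]].
  by rewrite y'0 subr0.
have [fz|/existsNP [x0 fx0]] := pselect (forall x, f x = 0).
  by exists 0 => y; rewrite fz ip0l.
have [x [_ [[/= fx ->] orth]]] := graph_projection hilb x0 0 lA cA.
set w := x0 - x in orth.
have fw : f w = f x0 by rewrite fD fN fx subr0.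
have fw0 : f w != 0 by rewrite fw; exact/eqP.
have ww : ip w w != 0.
  apply: contra fw0 => /eqP ww; have /eqP : `|w| ^+ 2 = 0 by rewrite hilb.
  by rewrite sqrf_eq0 normr_eq0 => /eqP ->; rewrite f0.
exists ((f w / ip w w) *: w) => y; rewrite ipZl.
set a := conjc (f y / f w).
have Ay : A (y - a *: w, 0).
  split=> //=; rewrite fD fN fZ /a conjcK divfK //; exact: subrr.
have := orth _ _ Ay; rewrite ip0r addr0 ipDr ipNr ipZr /a conjcK => /eqP.
rewrite subr_eq0 => /eqP ->.
by field; rewrite fw0 ww.
Qed.

End Adjoints.

(** * Bounded positive operators *)

Section BoundedOperators.
Context {R : realType} {H : completeNormedModType R[i]}.
Variable ip : {dot H for Num.conj}.
Hypothesis hilb : hilbert ip.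
Implicit Types (x y z : H) (Z K A : H -> H).
Local Notation rip := (re_ip ip).

Definition symmetric_op Z := forall x y, ip (Z x) y = ip x (Z y).

Definition bounded_by (c : R) Z := forall x, nrm (Z x) <= c * nrm x.

(** Symmetry makes <Zx, x> real, so positivity can be asked of its real part. *)
Definition bounded_positive Z :=
  [/\ symmetric_op Z, exists c, bounded_by c Z & forall x, 0 <= rip (Z x) x].

Lemma symmetric_linear Z : symmetric_op Z -> linear Z.
Proof.
by move=> sZ a x y; apply: (ip_inj hilb) => z; rewrite sZ ipDl ipZl ipDl ipZl !sZ.
Qed.

Lemma symmetric_rip Z x y : symmetric_op Z -> rip (Z x) y = rip x (Z y).
Proof. by move=> sZ; rewrite /re_ip sZ. Qed.

Section PositiveCombinations.
Variable A : H -> H.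
Hypothesis sA : symmetric_op A.
Hypothesis bA : bounded_by 1 A.

(* poscomb F c: F = p(A) and c = p(1) for a polynomial p with nonnegative
   coefficients, so that |F| <= c. *)
Inductive poscomb : (H -> H) -> R -> Prop :=
| poscomb0 : poscomb (fun=> 0) 0
| poscombX : poscomb A 1
| poscombD F G c d : poscomb F c -> poscomb G d ->
    poscomb (fun x => F x + G x) (c + d)
| poscombM F G c d : poscomb F c -> poscomb G d ->
    poscomb (fun x => F (G x)) (c * d)
| poscombh F c : poscomb F c -> poscomb (fun x => (2^-1)%:C *: F x) (2^-1 * c).

Lemma poscomb_ge0 F c : poscomb F c -> 0 <= c.
Proof. by elim=> // *; rewrite ?addr_ge0 ?mulr_ge0 // invr_ge0. Qed.

Lemma poscomb_bounded F c : poscomb F c -> bounded_by c F.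
Proof.
elim=> {F c} [x||F G c d _ bF _ bG x|F G c d pF bF _ bG x|F c _ bF x].
- by rewrite nrm0 mul0r.
- exact: bA.
- by rewrite mulrDl; apply: le_trans (nrmD _ _) (lerD (bF x) (bG x)).
- rewrite -mulrA; apply: le_trans (bF _) _.
  by rewrite ler_wpM2l ?(poscomb_ge0 pF).
- by rewrite nrmZ ger0_norm ?invr_ge0 // -mulrA ler_wpM2l ?invr_ge0.
Qed.

Lemma poscomb_linear F c : poscomb F c -> linear F.
Proof.
elim=> {F c} [a x y||F G c d _ lF _ lG a x y|F G c d _ lF _ lG a x y|F c _ lF a x y].
- by rewrite scaler0 addr0.
- exact: symmetric_linear.
- by rewrite lF lG scalerDr addrACA.
- by rewrite lG lF.
- by rewrite lF scalerDr !scalerA mulrC.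
Qed.

Lemma poscomb_comm F c (U : H -> H) : poscomb F c -> linear U ->
  (forall x, U (A x) = A (U x)) -> forall x, U (F x) = F (U x).
Proof.
move=> pF lU UA.
elim: pF => {F c} [x||F G c d _ cF _ cG x|F G c d _ cF _ cG x|F c _ cF x].
- exact: lin0.
- exact: UA.
- by rewrite (linD lU) cF cG.
- by rewrite cF cG.
- by rewrite (linZ lU) cF.
Qed.

Lemma poscombC F c G d : poscomb F c -> poscomb G d ->
  forall x, F (G x) = G (F x).
Proof.
move=> pF pG; apply: poscomb_comm pG _ _; first exact: poscomb_linear pF.
by move=> x; rewrite -(poscomb_comm pF) //; exact: symmetric_linear.
Qed.

Lemma poscomb_symmetric F c : poscomb F c -> symmetric_op F.
Proof.
elim=> {F c} [x y||F G c d _ sF _ sG x y|F G c d pF sF pG sG x y|F c _ sF x y].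
- by rewrite ip0l ip0r.
- exact: sA.
- by rewrite ipDl ipDr sF sG.
- by rewrite sF sG (poscombC pF pG).
- by rewrite ipZl ipZr conjc_real sF.
Qed.

(** The aim is a Y with (1 - Y)^2 = 1 - A, that is, Y = (A + Y^2)/2. *)
Fixpoint root_iter n : H -> H :=
  if n is k.+1 then fun x => (2^-1)%:C *: (A x + root_iter k (root_iter k x))
  else fun=> 0.

(** The same iteration at A = 1: it gives the sums of coefficients of the iterates. *)
Fixpoint root_bound n : R :=
  if n is k.+1 then 2^-1 * (1 + root_bound k * root_bound k) else 0.

Lemma poscomb_iter n : poscomb (root_iter n) (root_bound n).
Proof.
elim: n => [|n IHn]; first exact: poscomb0.
exact: poscombh (poscombD poscombX (poscombM IHn IHn)).
Qed.

(** The iterates commute, so Y_(n+2) - Y_(n+1) = (Y_(n+1) - Y_n)(Y_(n+1) + Y_n)/2 and nonnegativity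
    of the coefficients propagates. Convergence of the operators is thereby controlled by that of
    the scalars [root_bound n]. *)
Lemma poscomb_iterS n :
  poscomb (fun x => root_iter n.+1 x - root_iter n x)
          (root_bound n.+1 - root_bound n).
Proof.
elim: n => [|n IHn].
  have := poscomb_iter 1; congr poscomb; last by rewrite /= subr0.
  by apply/funext => x; rewrite [root_iter 0 x]/= subr0.
have := poscombh (poscombM IHn (poscombD (poscomb_iter n.+1) (poscomb_iter n))).
congr poscomb; last first.
  rewrite [in RHS]/=; rewrite [root_bound n.+1]/=.
  by field.
have -> : root_iter n.+2 = fun x =>
  (2^-1)%:C *: (A x + root_iter n.+1 (root_iter n.+1 x)) by [].
have YS x : root_iter n.+1 x = (2^-1)%:C *: (A x + root_iter n (root_iter n x)).
  by [].
have lY k := poscomb_linear (poscomb_iter k).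
have YC := poscombC (poscomb_iter n) (poscomb_iter n.+1).
apply/funext => x; rewrite [X in _ = _ - X]YS -scalerBr (linD (lY n.+1)) (linD (lY n)) YC.
by congr (_ *: _); rewrite addrKA (addrC (A x) (root_iter n.+1 _)) addrKA.
Qed.

Lemma poscomb_iterB n m : (n <= m)%N ->
  poscomb (fun x => root_iter m x - root_iter n x)
          (root_bound m - root_bound n).
Proof.
move=> /subnK <-; elim: (m - n)%N => [|k IHk].
  have := poscomb0; congr poscomb; last by rewrite subrr.
  by apply/funext => x; rewrite subrr.
rewrite addSn; have := poscombD (poscomb_iterS (k + n)) IHk.
congr poscomb; last by rewrite subrKA.
by apply/funext => x; rewrite subrKA.
Qed.

Lemma root_bound_le1 n : root_bound n <= 1.
Proof.
elim: n => [|n IHn] //=; have := poscomb_ge0 (poscomb_iter n).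
nra.
Qed.

Lemma root_bound_cauchy (e : R) : 0 < e ->
  exists n, forall m, (n <= m)%N -> root_bound m - root_bound n < e.
Proof.
move=> e0; pose S := range root_bound.
have supS : has_sup S.
  split; first by exists 0, 0%N.
  by exists 1 => _ [n _ <-]; exact: root_bound_le1.
have [_ [n _ <-] hn] := sup_adherent e0 supS; exists n => m nm.
have : root_bound m <= sup S by apply: sup_upper_bound => //; exists m.
lra.
Qed.

(* The limit Y of the iteration Y_(n+1) = (A + Y_n^2)/2 solves Y = (A + Y^2)/2. *)
Lemma contraction_fixpoint : exists Y, [/\ symmetric_op Y, bounded_by 1 Y &
  forall x, Y (Y x) = Y x + Y x - A x].
Proof.
have bI n m x : (n <= m)%N ->
    nrm (root_iter m x - root_iter n x) <= (root_bound m - root_bound n) * nrm x.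
  by move=> nm; have := poscomb_bounded (poscomb_iterB nm) x.
have cauM x (e : R) : 0 < e -> exists n, forall m, (n <= m)%N ->
    (root_bound m - root_bound n) * nrm x < e.
  move=> e0; have x0 := nrm_ge0 x; have x1 : 0 < nrm x + 1 by lra.
  have e1 : 0 < e / (nrm x + 1) by rewrite divr_gt0.
  have eE : e = e / (nrm x + 1) * (nrm x + 1) by rewrite divfK // gt_eqF.
  have [n nP] := root_bound_cauchy e1; exists n => m /nP.
  rewrite {2}eE; move: (e / _) e1 => d d0; nra.
have [Y YP] : {Y : H -> H & forall x, cvgto (fun n => root_iter n x) (Y x)}.
  apply: (@choice _ _ (fun x l => cvgto (fun n => root_iter n x) l)) => x.
  apply: nrm_complete => e /(cauM x) [n nP]; exists n => m nm.
  exact: le_lt_trans (bI _ _ _ nm) (nP m nm).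
have sI n := poscomb_symmetric (poscomb_iter n).
have sY : symmetric_op Y.
  by move=> x y; exact: (ip_cvgto hilb (YP x) (YP y) (fun n => sI n x y)).
have b1 n x : nrm (root_iter n x) <= nrm x.
  have := poscomb_bounded (poscomb_iter n) x; have := root_bound_le1 n.
  have := nrm_ge0 x; nra.
have bY : bounded_by 1 Y.
  move=> x; rewrite mul1r; apply/ler_addgt0Pr => e /(YP x) [n nP].
  have := nrmD (Y x - root_iter n x) (root_iter n x); rewrite subrK.
  have := b1 n x; have := nP n (leqnn n); rewrite nrmB; lra.
exists Y; split=> // x.
have : cvgto (fun n => root_iter n (root_iter n x)) (Y (Y x)).
  move=> e e0; have e2 : 0 < e / 2 by lra.
  have [[n1 h1] [n2 h2]] := (YP x _ e2, YP (Y x) _ e2).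
  exists (maxn n1 n2) => m; rewrite geq_max => /andP[/h1 {}h1 /h2 {}h2].
  have := nrm_tri (root_iter m (root_iter m x)) (root_iter m (Y x)) (Y (Y x)).
  rewrite -(linB (poscomb_linear (poscomb_iter m))).
  have := b1 m (root_iter m x - Y x); lra.
move=> YY; apply: cvgto_uniq YY _ => e e0; have e2 : 0 < e / 2 by lra.
have [n nP] := YP x _ e2; exists n => m nm.
(* By the recursion, Y_m Y_m x = 2 Y_(m+1) x - A x, whose limit is 2 Y x - A x. *)
have -> : root_iter m (root_iter m x) = 2%:C *: root_iter m.+1 x - A x.
  by rewrite /= scalerA -rmorphM divff ?pnatr_eq0 // scale1r [A x + _]addrC addrK.
have -> : Y x + Y x = 2%:C *: Y x.
  by rewrite rmorphMn rmorph1 scaler_nat mulr2n.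
rewrite opprB addrA subrK -scalerBr nrmZ ger0_norm //.
have := nP _ (leqW nm); lra.
Qed.

End PositiveCombinations.

Lemma positive_contraction_sqrt X :
  symmetric_op X -> bounded_by 1 X -> (forall x, 0 <= rip (X x) x) ->
  exists2 Z, bounded_positive Z & forall x, Z (Z x) = X x.
Proof.
move=> sX bX pX.
(* Expand <X(x - Xx), x - Xx> >= 0 and use |X(Xx)| <= |Xx|. This inequality makes A = 1 - X a
   contraction, and the root sought is 1 - Y. *)
have X2 x : nrm (X x) ^+ 2 <= rip (X x) x.
  have := pX (x - X x); rewrite (linB (symmetric_linear sX)) !ripE.
  rewrite (symmetric_rip (X x) x sX) -(nrm2 hilb).
  have := rip_le hilb (X (X x)) (X x); have := bX (X x); have := nrm_ge0 (X x).
  nra.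
pose A x := x - X x.
have sA : symmetric_op A by move=> x y; rewrite /A ipDl ipDr ipNl ipNr sX.
have bA : bounded_by 1 A.
  move=> x; rewrite mul1r; apply: sqr_le_imp; first exact: nrm_ge0.
  rewrite /A (nrm2 hilb (x - _)) !ripE (ripC ip x (X x)) -!(nrm2 hilb).
  have := X2 x; have := pX x; lra.
have [Y [sY bY YY]] := contraction_fixpoint sA bA.
have lY := symmetric_linear sY.
exists (fun x => x - Y x); [split|].
- by move=> x y; rewrite ipDl ipDr ipNl ipNr sY.
- exists 2 => x; have := nrmD x (- Y x); rewrite nrmN; have := bY x; lra.
- move=> x; rewrite !ripE -(nrm2 hilb).
  have := rip_le hilb (Y x) x; have := bY x; have := nrm_ge0 x; nra.
move=> x; rewrite (linB lY) YY /A.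
by apply: (ip_inj hilb) => z; rewrite !(ipDl, ipNl); ring.
Qed.

Lemma positive_sqrt K : bounded_positive K ->
  exists2 Z, bounded_positive Z & forall x, Z (Z x) = K x.
Proof.
move=> [sK [c0 bK0] pK]; pose c := `|c0| + 1.
have c_gt0 : 0 < c by have := normr_ge0 c0; rewrite /c; lra.
have bK : bounded_by c K.
  move=> x; apply: le_trans (bK0 x) _; rewrite ler_wpM2r ?nrm_ge0 //.
  by have := ler_norm c0; rewrite /c; lra.
have cV0 : 0 < c^-1 by rewrite invr_gt0.
have [|x|x|Z [sZ [d bZ] pZ] ZZ] :=
    @positive_contraction_sqrt (fun x => (c^-1)%:C *: K x).
- by move=> x y; rewrite ipZl ipZr conjc_real sK.
- by rewrite mul1r nrmZ gtr0_norm // -ler_pdivlMl // invrK; exact: bK.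
- by rewrite ripZl mulr_ge0 // ltW.
have s0 := sqrtr_ge0 c.
exists (fun x => (Num.sqrt c)%:C *: Z x); [split|].
- by move=> x y; rewrite ipZl ipZr conjc_real sZ.
- by exists (Num.sqrt c * d) => x; rewrite nrmZ ger0_norm // -mulrA ler_wpM2l.
- by move=> x; rewrite ripZl mulr_ge0.
move=> x; rewrite (linZ (symmetric_linear sZ)) ZZ !scalerA -!rmorphM.
by rewrite -expr2 sqr_sqrtr ?ltW // divff ?gt_eqF // scale1r.
Qed.

Section LogConvex.
Variables (a : nat -> R) (C M : R).
Hypothesis a_ge0 : forall n, 0 <= a n.
Hypothesis M0 : 0 < M.
Hypothesis a_convex : forall n, a n.+1 ^+ 2 <= a n * a n.+2.
Hypothesis a_le : forall n, a n <= C * M ^+ n.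

(** If a_1 = M (1 + h) a_0 with h > 0, log-convexity keeps every later ratio at least M (1 + h). By
    Bernoulli, a_n >= M^n (1 + n h) a_0, which outgrows C M^n. *)
Lemma logconvex_ratio : a 1 <= M * a 0.
Proof.
rewrite leNgt; apply/negP => aM.
have a00 : 0 < a 0.
  rewrite lt_def a_ge0 andbT; apply: contraL aM => /eqP a0.
  by have := a_convex 0; rewrite a0 mulr0 mul0r -leNgt; have := a_ge0 1; nra.
pose h := a 1 / (M * a 0) - 1.
have Ma0 : 0 < M * a 0 by rewrite mulr_gt0.
have h0 : 0 < h by rewrite subr_gt0 ltr_pdivlMr // mul1r.
have ratio n : 0 < a n /\ M * (1 + h) * a n <= a n.+1.
  elim: n => [|n [an IHn]].
    by split=> //; rewrite mulrAC /h subrKC mulrC divfK // gt_eqF.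
  have Mh : 0 < M * (1 + h) by rewrite mulr_gt0 //; lra.
  have an1 : 0 < a n.+1 by apply: lt_le_trans IHn; rewrite mulr_gt0.
  split=> //; rewrite -(ler_pM2l an).
  by have := a_convex n; nra.
have grow n : M ^+ n * (1 + n%:R * h) * a 0 <= a n.
  elim: n => [|n IHn]; first by rewrite expr0 mul0r addr0 !mul1r.
  have [an] := ratio n; apply: le_trans.
  have Mh : 0 < M * (1 + h) by rewrite mulr_gt0 //; lra.
  apply: le_trans (_ : M * (1 + h) * (M ^+ n * (1 + n%:R * h) * a 0) <= _).
    rewrite exprS -natr1; have Mn : 0 < M * M ^+ n * a 0 by rewrite !mulr_gt0 ?exprn_gt0.
    have n0 : 0 <= n%:R :> R by rewrite ler0n.
    move: (n%:R) n0 => N N0.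
    have -> : M * (1 + h) * (M ^+ n * (1 + N * h) * a 0) =
      M * M ^+ n * a 0 * ((1 + h) * (1 + N * h)) by ring.
    have -> : M * M ^+ n * (1 + (N + 1) * h) * a 0 =
      M * M ^+ n * a 0 * (1 + (N + 1) * h) by ring.
    by rewrite ler_pM2l //; nra.
  by rewrite ler_pM2l.
have CM n : n%:R * (h * a 0) <= C.
  have Mn : 0 < M ^+ n by rewrite exprn_gt0.
  rewrite -(ler_pM2l Mn); apply: le_trans (_ : a n <= _); last by rewrite mulrC a_le.
  apply: le_trans (grow n); nra.
have ha : 0 < h * a 0 by rewrite mulr_gt0.
have := CM (Num.truncn (C / (h * a 0))).+1.
rewrite -ler_pdivlMr // leNgt => /negP; apply.
exact: truncnS_gt.
Qed.

End LogConvex.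

(* If F = A W^2 with A symmetric, then N = W A W satisfies N^n (W y) = W (F^n y),
   which grows at most like M^n; since n |-> |N^n u| is log-convex for symmetric
   N, this forces |N u| <= M |u|. *)
Lemma heinz_bound W F (M w : R) : symmetric_op W -> bounded_by w W ->
  0 < M -> bounded_by M F ->
  (forall x y, ip (F x) (W (W y)) = ip (W (W x)) (F y)) ->
  forall y, rip (F y) (W (W y)) <= M * nrm (W y) ^+ 2.
Proof.
move=> sW bW M0 bF sF y.
have a0 n : 0 <= nrm (W (iter n F y)) by exact: nrm_ge0.
have := @logconvex_ratio (fun n => nrm (W (iter n F y))) (`|w| * nrm y) M a0 M0.
move=> /=.
(* For u = F^n y, |W F u|^2 = <F u, W^2 F u> = <W^2 u, F F u> = <W u, W F F u>, then
   Cauchy-Schwarz. *)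
have h1 n : nrm (W (F (iter n F y))) ^+ 2 <=
    nrm (W (iter n F y)) * nrm (W (F (F (iter n F y)))).
  set u := iter n F y.
  rewrite (nrm2 hilb) {1}/re_ip sW sF sW.
  exact: rip_le.
have h2 n : nrm (W (iter n F y)) <= `|w| * nrm y * M ^+ n.
  apply: le_trans (bW _) _; apply: le_trans (_ : `|w| * nrm (iter n F y) <= _).
    by rewrite ler_wpM2r ?nrm_ge0 // ler_norm.
  rewrite -mulrA ler_wpM2l //.
  elim: n => [|n IHn]; first by rewrite expr0 mulr1.
  by apply: le_trans (bF _) _; rewrite exprS mulrCA ler_pM2l.
move=> /(_ h1 h2) h3.
rewrite (ripC ip (F y)) (symmetric_rip _ _ sW).
have := rip_le hilb (W y) (W (F y)); have := nrm_ge0 (W y); nra.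
Qed.

End BoundedOperators.

(** * The closed graph theorem *)

Section ClosedGraph.
Context {R : realType} {X Y : completeNormedModType R[i]}.
Variable U : X -> Y.
Hypothesis lU : linear U.

(** Baire's argument: if no sublevel set of |U .| is dense in a ball, one can choose nested balls
    avoiding these sets one after the other. Their common point l would have |U l| > n for every
    n. *)
Lemma baire_sublevel : exists (n : nat) x0 (r : R), 0 < r /\
  forall h, nrm (h - x0) < r -> forall e : R, 0 < e ->
    exists2 a, nrm (U a) <= n%:R & nrm (h - a) < e.
Proof.
apply: contrapT => noball.
(* A state is (stage, (centre, radius)); p is a ball inside s on which |U .| exceeds the stage of
   s. *)
pose P (s p : nat * (X * R)) := 0 < s.2.2 ->
  [/\ 0 < p.2.2, p.2.2 < s.1.+1%:R^-1, nrm (p.2.1 - s.2.1) + p.2.2 <= s.2.2,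
    p.1 = s.1.+1 & forall a, nrm (a - p.2.1) <= p.2.2 -> s.1%:R < nrm (U a)].
have [f fP] : {f & forall s, P s (f s)}.
  apply: choice => -[n [x r]]; rewrite /P /=.
  have [r0|] := boolP (0 < r); last by exists (0%N, (0, 0)).
  have [h [hx [e e0 he]]] : exists h, nrm (h - x) < r /\
      exists2 e : R, 0 < e & forall a, nrm (U a) <= n%:R -> e <= nrm (h - a).
    apply: contrapT => noh; apply: noball; exists n, x, r; split=> // h hx e e0.
    apply: contrapT => noa; apply: noh; exists h; split=> //; exists e => // a an.
    by rewrite leNgt; apply/negP => ha; apply: noa; exists a.
  have n0 : 0 < n.+1%:R^-1 :> R by rewrite invr_gt0 ltr0n.
  exists (n.+1, (h, Num.min (e / 2) (Num.min (r - nrm (h - x)) (n.+1%:R^-1 / 2)))).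
  move=> _ /=; set r' := Num.min _ _.
  have [r1 [r2 r3]] : r' <= e / 2 /\ r' <= r - nrm (h - x) /\ r' <= n.+1%:R^-1 / 2.
    by rewrite /r' !ge_min !lexx !orbT.
  have r'0 : 0 < r' by rewrite !lt_min subr_gt0 hx !divr_gt0.
  move: r1 r2 r3 r'0; move: r' (n.+1%:R^-1) n0 => r' V V0 r1 r2 r3 r'0.
  split=> //; [lra|lra|] => a ar.
  rewrite ltNge; apply/negP => /he; rewrite nrmB; lra.
(* The initial state goes through f once, so [s n] has stage n + 1 and a positive radius. *)
pose s := fix s n := if n is k.+1 then f (s k) else f (0%N, (0, 1)).
have s0 n : 0 < (s n).2.2 /\ (s n).1 = n.+1.
  elim: n => [|n [IHn IHn']]; first by have [] := fP (0%N, (0, 1)) ltr01.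
  by have [? _ _ -> _] := fP _ IHn; rewrite IHn'.
have sS n : [/\ (s n.+1).2.2 < n.+2%:R^-1,
    nrm ((s n.+1).2.1 - (s n).2.1) + (s n.+1).2.2 <= (s n).2.2 &
    forall a, nrm (a - (s n.+1).2.1) <= (s n.+1).2.2 -> n%:R < nrm (U a)].
  have [sn0 sn1] := s0 n; have [_ h1 h2 _ h3] := fP _ sn0; split=> //.
    by rewrite sn1 in h1.
  move=> a /h3; rewrite sn1; apply: lt_trans; by rewrite ltr_nat.
have nested n k : nrm ((s (k + n)%N).2.1 - (s n).2.1) + (s (k + n)%N).2.2 <= (s n).2.2.
  elim: k => [|k IHk]; first by rewrite subrr nrm0 add0r.
  have [_ h _] := sS (k + n)%N; have := nrm_tri (s (k + n).+1).2.1 (s (k + n)%N).2.1 (s n).2.1.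
  rewrite addSn; lra.
have [l sl] : exists l, cvgto (fun n => (s n).2.1) l.
  apply: nrm_complete => e /inv_nat_lt [n nV]; exists n.+1 => m /subnK <-.
  have := nested n.+1 (m - n.+1)%N; have [h _ _] := sS n.
  have := nV n.+1 (leqnSn n); have [] := s0 (m - n.+1 + n.+1)%N.
  move: (n.+2%:R^-1) h => V; lra.
have ln n : n%:R < nrm (U l).
  have [_ _] := sS n; apply; apply/ler_addgt0Pr => e /sl [m mP].
  have := nested n.+1 m; have := mP (m + n.+1)%N (leq_addr _ _).
  have := nrm_tri l (s (m + n.+1)%N).2.1 (s n.+1).2.1.
  rewrite (nrmB l (s (m + _)%N).2.1); have [] := s0 (m + n.+1)%N; lra.
have := ln (Num.truncn (nrm (U l))).+1; apply/negP; rewrite -leNgt ltW //.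
exact: truncnS_gt.
Qed.

(** Scale h by t so that t |h| = r/2, approximate x0 + t h and x0 within r/8 in the sublevel set,
    subtract and divide by t. The error is at most (r/4)/t = |h|/2, and the value of U at most 2n/t
    = (4n/r) |h|. *)
Lemma approximate_preimage : exists2 C : R, 0 < C & forall h, exists a,
  nrm (h - a) <= nrm h / 2 /\ nrm (U a) <= C * nrm h.
Proof.
have [n [x0 [r [r0 ball]]]] := baire_sublevel.
have n0 : 0 <= n%:R :> R by rewrite ler0n.
have q0 : 0 <= 4 * n%:R / r by rewrite divr_ge0 ?mulr_ge0 // ltW.
exists (4 * n%:R / r + 1); first by lra.
move=> h; have [->|h0] := eqVneq h 0.
  by exists 0; rewrite (lin0 lU) subr0 !nrm0 mul0r mulr0.
have hp : 0 < nrm h.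
  by rewrite lt_def nrm_ge0 andbT; apply: contra h0 => /eqP/nrm_eq0 ->.
pose t := r / (2 * nrm h).
have t0 : 0 < t by rewrite divr_gt0 // mulr_gt0.
have tV : t^-1 = 2 * nrm h / r by rewrite /t invf_div.
have e0 : 0 < r / 8 by rewrite divr_gt0.
have [|a1 a1n a1h] := ball (x0 + t%:C *: h) _ (r / 8) e0.
  rewrite addrAC subrr add0r nrmZ gtr0_norm //.
  have -> : t * nrm h = r / 2 by rewrite /t; field; rewrite gt_eqF.
  by lra.
have [|a2 a2n a2h] := ball x0 _ (r / 8) e0; first by rewrite subrr nrm0.
exists ((t^-1)%:C *: (a1 - a2)); split.
  have -> : h - (t^-1)%:C *: (a1 - a2) =
      (t^-1)%:C *: ((x0 + t%:C *: h - a1) - (x0 - a2)).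
    have {1}-> : h = (t^-1)%:C *: (t%:C *: h).
      by rewrite scalerA -rmorphM mulVf ?gt_eqF // scale1r.
    rewrite -scalerBr; congr (_ *: _).
    by rewrite !opprB [RHS]addrC -[x0 + _ - _]addrA subrKA addrCA.
  have := nrmB a2 x0.
  have := nrmD (x0 + t%:C *: h - a1) (- (x0 - a2)); rewrite nrmN => h1 h2.
  rewrite nrmZ gtr0_norm ?invr_gt0 // -ler_pdivlMl ?invr_gt0 // invrK.
  have -> : t * (nrm h / 2) = r / 4 by rewrite /t; field; rewrite gt_eqF.
  lra.
rewrite (linZ lU) (linB lU) nrmZ gtr0_norm ?invr_gt0 // tV.
have := nrmD (U a1) (- U a2); rewrite nrmN => h1.
apply: le_trans (_ : 2 * nrm h / r * (2 * n%:R) <= _).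
  by rewrite ler_wpM2l //; [rewrite divr_ge0 ?mulr_ge0 ?ltW | lra].
have -> : 2 * nrm h / r * (2 * n%:R) = 4 * n%:R / r * nrm h by field; rewrite gt_eqF.
by rewrite ler_pM2r // lerDl.
Qed.

(** Iterating the approximation leaves remainders s_n with |s_n| <= 2^-n |x|, while U(x - s_n) is a
    Cauchy sequence bounded by the geometric sum 2 C |x|. Closedness identifies its limit with U
    x. *)
Lemma closed_graph_bounded :
  (forall x y, (forall e : R, 0 < e ->
     exists x', nrm (x - x') < e /\ nrm (y - U x') < e) -> y = U x) ->
  exists2 c : R, 0 < c & forall x, nrm (U x) <= c * nrm x.
Proof.
move=> clU; have [C C0 CP] := approximate_preimage.
have [g gP] := choice CP.
exists (2 * C); first by rewrite mulr_gt0.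
move=> x; pose s := fix s n := if n is k.+1 then s k - g (s k) else x.
have sN n : nrm (s n) <= 2^-1 ^+ n * nrm x.
  elim: n => [|n IHn]; first by rewrite mul1r.
  have [+ _] := gP (s n) => /le_trans; apply.
  rewrite exprS mulrC -mulrA ler_pM2l ?invr_gt0 //.
have h0 n : 0 < 2^-1 ^+ n :> R by rewrite exprn_gt0 ?invr_gt0.
have dU n : U (s n.+1) - U (s n) = - U (g (s n)).
  by rewrite -/s (linB lU) addrAC subrr sub0r.
(* The right-hand side is the exact sum of the increments C 2^-j |x| for n <= j < k + n. *)
have US n k : nrm (U (s (k + n)%N) - U (s n)) <=
    2 * C * nrm x * (2^-1 ^+ n - 2^-1 ^+ (k + n)).
  elim: k => [|k IHk]; first by rewrite !subrr nrm0 mulr0.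
  have := nrm_tri (U (s (k + n).+1)) (U (s (k + n)%N)) (U (s n)).
  rewrite dU nrmN; have [_] := gP (s (k + n)%N).
  have := ler_wpM2l (ltW C0) (sN (k + n)%N).
  rewrite addSn (exprS _ (k + n)%N); have := nrm_ge0 x.
  move: IHk; move: (2^-1 ^+ (k + n)) (2^-1 ^+ n) => p q; lra.
have half_small (e : R) : 0 < e -> exists n, forall m, (n <= m)%N ->
    2^-1 ^+ m * nrm x < e.
  move=> e0; have x0 := nrm_ge0 x.
  have e1 : 0 < e / (nrm x + 1) by rewrite divr_gt0 //; lra.
  have [n nV] := inv_nat_lt e1; exists n => m /nV mV.
  have pm : 2^-1 ^+ m <= m.+1%:R^-1 :> R.
    rewrite exprVn lef_pV2 ?posrE ?exprn_gt0 ?ltr0n //.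
    by rewrite -natrX ler_nat ltn_expl.
  have eE : e = e / (nrm x + 1) * (nrm x + 1) by rewrite divfK // gt_eqF //; lra.
  rewrite eE; move: (2^-1 ^+ m) (m.+1%:R^-1) (e / _) (h0 m) pm mV e1 => p V d *; nra.
have small (e : R) : 0 < e -> exists n, forall m, (n <= m)%N ->
    2 * C * nrm x * 2^-1 ^+ m < e.
  move=> e0; have C2 : 0 < 2 * C by lra.
  have [|n nP] := half_small (e / (2 * C)); first by rewrite divr_gt0.
  by exists n => m /nP; rewrite ltr_pdivlMr //; move: (2^-1 ^+ m) => p; lra.
have [y Uy] : exists y, cvgto (fun n => U (x - s n)) y.
  apply: nrm_complete => e /small [n nP]; exists n => m /subnK <-.
  rewrite -(linB lU) opprB addrC subrKA.
  have := US n (m - n)%N; rewrite nrmB -(linB lU).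
  have := nP n (leqnn n); have := h0 (m - n + n)%N.
  have := mulr_ge0 (ltW C0) (nrm_ge0 x).
  move: (2^-1 ^+ (m - n + n)) (2^-1 ^+ n) => p q; nra.
have yE : y = U x.
  apply: clU => e e0; have [n1 h1] := half_small _ e0; have [n2 h2] := Uy _ e0.
  exists (x - s (maxn n1 n2)); split.
    rewrite opprB addrC subrK; apply: le_lt_trans (sN _) _.
    by apply: h1; exact: leq_maxl.
  by rewrite nrmB; apply: h2; exact: leq_maxr.
rewrite -yE; apply/ler_addgt0Pr => e /Uy [n nP].
have /= h1 := nP n (leqnn n).
have := US 0%N n; rewrite addn0 expr0 nrmB -(linB lU) -/s => h2.
have := nrmD (y - U (x - s n)) (U (x - s n)); rewrite subrK (nrmB y (U _)) => h3.
have := mulr_ge0 (mulr_ge0 (ltW C0) (nrm_ge0 x)) (ltW (h0 n)).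
have h2' : nrm (U (x - s n)) <= 2 * C * nrm x * (1 - 2^-1 ^+ n) by exact: h2.
move: (2^-1 ^+ n) h2' => p; lra.
Qed.

End ClosedGraph.

(** * Square roots of positive selfadjoint graphs *)

Section SelfadjointGraphs.
Context {R : realType} {H : completeNormedModType R[i]}.
Variable ip : {dot H for Num.conj}.
Hypothesis hilb : hilbert ip.
Implicit Types (A P S : set (H * H)) (x y z : H) (K W Z : H -> H).
Local Notation rip := (re_ip ip).

Definition inverse_graph Z : set (H * H) := [set p | p.1 = Z p.2].

Lemma inverse_graphP Z x y : inverse_graph Z (x, y) <-> x = Z y.
Proof. by []. Qed.

Lemma ip_injr x z : (forall y, ip y x = ip y z) -> x = z.
Proof. by move=> xz; apply: (ip_inj hilb) => y; rewrite ipC xz -ipC. Qed.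

(** Project onto the closure of S x {0}: the remainder is orthogonal to S, hence zero. *)
Lemma orth_dense (S : set H) : S 0 ->
  (forall c x y, S x -> S y -> S (c *: x + y)) ->
  (forall y, (forall x, S x -> ip x y = 0) -> y = 0) -> dense S.
Proof.
move=> S0 lS oS; apply/denseP => h.
set A : set (H * H) := [set p | S p.1 /\ p.2 = 0].
have lA : lin_graph A.
  split=> // c x y x' y' [/= Sx ->] [/= Sx' ->].
  by split=> /=; [exact: lS | rewrite scaler0 addr0].
have [x [y [Cxy orth]]] := graph_projection hilb h 0 (lin_closure_graph lA)
  (@closed_closure_graph _ _ A).
have hx : h - x = 0.
  apply: oS => a Sa; have := orth a 0; rewrite ip0r addr0 => h0.
  by rewrite ipC h0 ?conjc0 //; apply: sub_closure_graph.
move=> e /Cxy [x' [y' [[Sx' _] xx _]]]; exists x' => //.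
by rewrite (subr0_eq hx).
Qed.

Lemma selfadjoint_lin A : selfadjoint ip A -> lin_graph A.
Proof. by move=> [_ <-]; exact: lin_adjoint. Qed.

Lemma selfadjoint_closed A : selfadjoint ip A -> closed_graph A.
Proof. by move=> [_ <-]; exact: closed_adjoint. Qed.

Lemma selfadjoint_functional A : selfadjoint ip A -> functional_graph A.
Proof. by move=> [dA <-]; exact: functional_adjoint. Qed.

Lemma selfadjointP A x y x' y' : selfadjoint ip A -> A (x, y) -> A (x', y') ->
  ip y x' = ip x y'.
Proof. by move=> [_ sA] Axy; rewrite -{1}sA => /(_ _ _ Axy). Qed.

Lemma positive_rip A x y : positive ip A -> A (x, y) -> 0 <= rip y x.
Proof. by move=> pA /pA /Re_le. Qed.

Lemma square_nrm2 A x y z : selfadjoint ip A -> A (x, y) -> A (y, z) ->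
  nrm y ^+ 2 = rip x z.
Proof. by move=> sA Axy Ayz; rewrite (nrm2 hilb) /re_ip (selfadjointP sA Axy Ayz). Qed.

Lemma op_sqrt_neq0 A : op_sqrt ip A !=set0 ->
  [/\ selfadjoint ip (op_sqrt ip A), positive ip (op_sqrt ip A) &
    op_comp (op_sqrt ip A) (op_sqrt ip A) = A].
Proof. by rewrite /op_sqrt; case: xgetP => [S _ //|_ [p]]. Qed.

Lemma inverse_selfadjoint Z : symmetric_op ip Z ->
  (forall y, Z y = 0 -> y = 0) -> selfadjoint ip (inverse_graph Z).
Proof.
move=> sZ kZ; have lZ := symmetric_linear hilb sZ; split.
  apply: orth_dense => [|c x y [u /inverse_graphP ->] [v /inverse_graphP ->]|y oy].
  - by exists 0; rewrite /inverse_graph /= (lin0 lZ).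
  - by exists (c *: u + v); rewrite /inverse_graph /= lZ.
  - apply: kZ; apply: ip_injr => u; rewrite -sZ ip0r; apply: oy.
    by exists u.
apply/seteqP; split=> -[u v] /=; rewrite /inverse_graph /=.
  by move=> adj; apply: ip_injr => w; rewrite -sZ; apply: adj.
by move=> -> x w /= ->; rewrite sZ.
Qed.

Lemma inverse_positive Z : bounded_positive ip Z ->
  positive ip (inverse_graph Z).
Proof.
move=> [sZ _ pZ] x y /inverse_graphP ->; rewrite -sZ.
have im0 : Im (ip (Z y) y) = 0.
  by have := ipC ip (Z y) y; rewrite -sZ; case: (ip (Z y) y) => a b [] /=; lra.
by rewrite lecE /= im0 eqxx; exact: pZ.
Qed.

(** The root Z of K shows that the inverse graph of K has a positive selfadjoint root; W is then
    read off from whichever root [op_sqrt] selects. *)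
Lemma op_sqrt_inverse K : bounded_positive ip K ->
  (forall y, K y = 0 -> y = 0) ->
  exists W, [/\ bounded_positive ip W, forall x, W (W x) = K x &
    op_sqrt ip (inverse_graph K) = inverse_graph W].
Proof.
move=> pK kK; have [Z [sZ bZ pZ] ZZ] := positive_sqrt hilb pK.
have [sP pP PP] : [/\ selfadjoint ip (op_sqrt ip (inverse_graph K)),
    positive ip (op_sqrt ip (inverse_graph K)) &
    op_comp (op_sqrt ip (inverse_graph K)) (op_sqrt ip (inverse_graph K))
      = inverse_graph K].
  rewrite /op_sqrt; case: xgetP => [S _ //|/(_ (inverse_graph Z)) []]; split.
  - apply: (inverse_selfadjoint sZ) => y Zy; apply: kK.
    by rewrite -ZZ Zy (lin0 (symmetric_linear hilb sZ)).
  - exact: inverse_positive.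
  - apply/seteqP; split=> -[x z]; rewrite /inverse_graph /op_comp /=.
      by move=> [y [-> ->]]; rewrite ZZ.
    by move=> ->; exists (Z z); rewrite ZZ.
set P := op_sqrt _ _ in sP pP PP *.
have lP := selfadjoint_lin sP.
have [W WP] : {W : H -> H & forall y, P (W y, y)}.
  apply: (@choice _ _ (fun y x => P (x, y))) => y.
  have : inverse_graph K (K y, y) by [].
  by rewrite -PP => -[u [/= _ Puy]]; exists u.
have WK y : W (W y) = K y.
  have : op_comp P P (W (W y), y) by exists (W y); split; exact: WP.
  by rewrite PP.
have PE : P = inverse_graph W.
  apply/seteqP; split=> -[x y]; rewrite /inverse_graph /=; last by move=> ->.
  (* P is injective: if P d = 0, then P (P d) = 0, so d = K 0 = 0. *)
  move=> Pxy; apply: subr0_eq; have := lin_graphB lP Pxy (WP y).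
  rewrite subrr => Pd; have : op_comp P P (x - W y, 0).
    by exists 0; split=> //=; exact: lP.1.
  rewrite PP /inverse_graph /= => ->.
  by have [sK _ _] := pK; rewrite (lin0 (symmetric_linear hilb sK)).
have sW : symmetric_op ip W.
  by move=> x y; exact: esym (selfadjointP sP (WP x) (WP y)).
have [sK [c bK] _] := pK.
exists W; split=> //; split=> //.
  (* |W x|^2 = <x, W W x> = <x, K x> <= |c| |x|^2. *)
  exists (Num.sqrt `|c|) => x; apply: sqr_le_imp.
    by rewrite mulr_ge0 ?sqrtr_ge0 ?nrm_ge0.
  rewrite exprMn sqr_sqrtr // (nrm2 hilb (W x)) (symmetric_rip _ _ sW) WK.
  apply: le_trans (rip_le hilb _ _) _.
  have := bK x; have := nrm_ge0 x; have := ler_norm c; nra.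
by move=> x; rewrite ripC; exact: positive_rip pP (WP x).
Qed.

(* The resolvent J = (1 + P)^-1 is bounded and positive; heinz_bound for
   J^(1/2) P' J^(1/2) gives <P' x, x> <= M (|p x|^2 + |x|^2) on the core D(P)
   of p. *)
Lemma heinz_domain (P p P' q : set (H * H)) (b : R) :
  selfadjoint ip p -> positive ip P -> selfadjoint ip P -> op_comp p p = P ->
  selfadjoint ip q -> selfadjoint ip P' -> op_comp q q = P' -> 0 <= b ->
  (forall x v, P (x, v) -> exists2 y, P' (x, y) & nrm y <= nrm v + b * nrm x) ->
  op_dom p `<=` op_dom q.
Proof.
move=> sp pP sP pp sq sP' qq b0 PP' x0 [y0 pxy0].
have sym x y z : p (x, y) -> op_adjoint ip p (y, z) -> P (x, z).
  by rewrite sp.2 -pp => pxy pyz; exists y.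
have [J JP] : {J : H -> H & forall h, P (J h, h - J h)}.
  apply: (@choice _ _ (fun h x => P (x, h - x))) => h.
  have [x [y [z [pxy pyz ->]]]] :=
    add_adjoint_comp_onto hilb h (selfadjoint_lin sp) (selfadjoint_closed sp).
  by exists x; rewrite addrAC subrr add0r; exact: sym pxy pyz.
have sJ : symmetric_op ip J.
  move=> x y; have := selfadjointP sP (JP x) (JP y).
  rewrite ipDl ipDr ipNl ipNr => /eqP; rewrite subr_eq subrK => /eqP.
  exact: esym.
have J2 x : nrm (J x) ^+ 2 <= rip (J x) x.
  have := positive_rip pP (JP x).
  rewrite !ripE -(nrm2 hilb) (ripC ip x); lra.
have bJ x : nrm (J x) <= nrm x.
  have := J2 x; have := rip_le hilb (J x) x.
  have := nrm_ge0 (J x); have := nrm_ge0 x; nra.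
have pJ : bounded_positive ip J.
  split=> //; first by exists 1 => x; rewrite mul1r.
  by move=> x; apply: le_trans (J2 x); exact: sqr_ge0.
have [V [sV [w bV] _] VV] := positive_sqrt hilb pJ.
have [F FP] : {F : H -> H & forall h, P' (J h, F h) /\
    nrm (F h) <= nrm (h - J h) + b * nrm (J h)}.
  apply: (@choice _ _ (fun h y => P' (J h, y) /\
    nrm y <= nrm (h - J h) + b * nrm (J h))) => h.
  by have [y P'y by_] := PP' _ _ (JP h); exists y.
(* F = P' J is bounded by 2 + b, since |h - J h| <= 2 |h| and |J h| <= |h|. *)
have M0 : 0 < 2 + b by lra.
have bF : bounded_by (2 + b) F.
  move=> h; have [_] := FP h; have := nrmD h (- J h); rewrite nrmN.
  have := bJ h; nra.
have FJ x y : ip (F x) (V (V y)) = ip (V (V x)) (F y).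
  by rewrite !VV; exact: selfadjointP sP' (FP x).1 (FP y).1.
have hz h : rip (F h) (J h) <= (2 + b) * rip (J h) h.
  have := heinz_bound hilb sV bV M0 bF FJ h.
  by rewrite VV (nrm2 hilb) -(symmetric_rip _ _ sV) VV.
have bnd x y z : p (x, y) -> op_adjoint ip p (y, z) -> exists2 w, q (x, w) &
    nrm w ^+ 2 <= (2 + b) * nrm x ^+ 2 + (2 + b) * nrm y ^+ 2.
  move=> pxy apyz; have Pxz := sym _ _ _ pxy apyz.
  (* The difference d = J(x + z) - x satisfies P d = -d, so positivity gives -|d|^2 >= 0. *)
  have xE : J (x + z) = x.
    apply: subr0_eq; apply: nrm_eq0; apply/eqP; rewrite -sqrf_eq0.
    have := positive_rip pP (lin_graphB (selfadjoint_lin sP) (JP (x + z)) Pxz).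
    rewrite (_ : x + z - J (x + z) - z = - (J (x + z) - x)); last first.
      by rewrite opprB addrAC addrK.
    rewrite ripNl -(nrm2 hilb) => h; rewrite eq_le sqr_ge0 andbT.
    by rewrite -oppr_ge0.
  have [+ _] := FP (x + z); rewrite xE -qq => -[u [/= qxu quF]].
  (* |q x|^2 = <x, P' x> <= (2 + b) <x, x + P x> = (2 + b)(|x|^2 + |p x|^2). *)
  exists u => //; rewrite (square_nrm2 sq qxu quF).
  rewrite sp.2 in apyz; have := hz (x + z).
  rewrite xE (ripC ip (F _)) ripDr -(nrm2 hilb) -(square_nrm2 sp pxy apyz); lra.
have [u qu _] := core_extension hilb
  (selfadjoint_lin sp) (selfadjoint_closed sp) (selfadjoint_functional sp)
  (selfadjoint_lin sq) (selfadjoint_closed sq) (selfadjoint_functional sq)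
  (ltW M0) (ltW M0) bnd pxy0.
by exists u.
Qed.

End SelfadjointGraphs.

(** * Solvable forms *)

Section Forms.
Context {R : realType} {H : completeNormedModType R[i]}.
Variable ip : {dot H for Num.conj}.
Hypothesis hilb : hilbert ip.
Context {D : pred H} {E : subBanachType D}.
Variable Omega : {sesquilinear E}.
Local Notation rip := (re_ip ip).
Implicit Types u v w : E.

Lemma bounded_map_nrm (U V : normedModType R[i]) (f : U -> V) :
  bounded_map f -> exists2 c : R, 0 <= c & forall x, nrm (f x) <= c * nrm x.
Proof.
move=> [M bM]; exists `|Re M| => // x.
have := Re_le (bM x); rewrite [M * _]mulrC (nrmE x) ReM_real mulrC => /le_trans; apply.
by rewrite ler_wpM2r ?nrm_ge0 // ler_norm.
Qed.

Lemma nrm_bounded_map (U V : normedModType R[i]) (f : U -> V) (c : R) :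
  (forall x, nrm (f x) <= c * nrm x) -> bounded_map f.
Proof. by move=> bf; exists c%:C => x; rewrite !nrmE -rmorphM lecR. Qed.

Lemma normc_le_ReIm (a : R[i]) : `|a| <= (`|Re a| + `|Im a|)%:C.
Proof.
rewrite normc_def lecR; apply: sqr_le_imp; first by rewrite addr_ge0.
rewrite sqr_sqrtr ?addr_ge0 ?sqr_ge0 // -(real_normK (num_real (Re a))).
rewrite -(real_normK (num_real (Im a))).
have := normr_ge0 (Re a); have := normr_ge0 (Im a); nra.
Qed.

Lemma conj_linear_Re0 (U : lmodType R[i]) (f : U -> R[i]) :
  (forall a x, f (a *: x) = conjc a * f x) -> (forall x, Re (f x) = 0) ->
  forall x, f x = 0.
Proof.
move=> fZ f0 x; have := f0 x; have := f0 ('i%C *: x).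
by rewrite fZ; case: (f x) => a b /= + ->; rewrite mul0r sub0r mulN1r opprK => ->.
Qed.

Lemma OmegaDl u v w : Omega (u + v) w = Omega u w + Omega v w.
Proof. by rewrite linearDl. Qed.
Lemma OmegaNl u w : Omega (- u) w = - Omega u w.
Proof. by rewrite linearNl. Qed.
Lemma OmegaZl a u w : Omega (a *: u) w = a * Omega u w.
Proof. by rewrite linearZl_LR. Qed.
Lemma OmegaDr u v w : Omega w (u + v) = Omega w u + Omega w v.
Proof. by rewrite linearDr. Qed.
Lemma OmegaZr a u w : Omega w (a *: u) = conjc a * Omega w u.
Proof. by rewrite linearZr /=; congr (_ * _); exact: conjE. Qed.

Lemma bounded_form_Re : bounded_form Omega ->
  exists2 c : R, 0 <= c & forall u v, `|Re (Omega u v)| <= c * nrm u * nrm v.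
Proof.
move=> [M M0 bM]; exists (Re M); first by have := Re_le (ltW M0).
move=> u v; rewrite -lecR; apply: le_trans (normc_ge_Re _) _.
apply: le_trans (bM u v) _.
by rewrite !nrmE !rmorphM /= (RRe_real (gtr0_real M0)).
Qed.

Lemma sub_surj (x : H) : D x -> exists u : E, val u = x.
Proof. by move=> Dx; exists (Sub x Dx); exact: SubK. Qed.

Lemma valD u v : val (u + v) = val u + val v :> H.
Proof. exact: raddfD. Qed.
Lemma valB u v : val (u - v) = val u - val v :> H.
Proof. exact: raddfB. Qed.
Lemma valZ a u : val (a *: u) = a *: val u :> H.
Proof. exact: linearZ_LR. Qed.
Lemma val0 : val (0 : E) = 0 :> H.
Proof. exact: raddf0. Qed.

(** For G = S^-1 this is the graph of S - B, so the lemma serves T, and S itself at B = 0. The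
    defect x - G(y + B x) is unchanged up to sign and error by passing to a nearby point of the
    graph, with Lipschitz constant at most 1 + g + g b. *)
Lemma closed_shifted_inverse (G B : H -> H) :
  bounded_operator G -> bounded_operator B ->
  closed_graph [set p | p.1 = G (p.2 + B p.1)].
Proof.
move=> [lG /bounded_map_nrm [g g0 bG]] [lB /bounded_map_nrm [b b0 bb]].
move=> [x y] cl /=.
apply: subr0_eq; apply: nrm_eq0; apply/eqP; rewrite eq_le nrm_ge0 andbT.
apply/ler_addgt0Pr => e e0; rewrite add0r.
have M0 : 0 < 1 + g + g * b by have := mulr_ge0 g0 b0; lra.
have d0 : 0 < e / (1 + g + g * b) by rewrite divr_gt0.
have eE : e = e / (1 + g + g * b) * (1 + g + g * b) by rewrite divfK // gt_eqF.
have [x' [y' [/= xG xx yy]]] := cl _ d0.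
have -> : x - G (y + B x) = (x - x') - G ((y - y') + B (x - x')).
  rewrite {1}xG -addrA -opprD -(linD lG); congr (_ - G _).
  by rewrite (linB lB) addrACA !subrKC.
have := nrmD (x - x') (- G (y - y' + B (x - x'))); rewrite nrmN => h0.
have h1 := bG (y - y' + B (x - x')).
have h2 := ler_wpM2l g0 (nrmD (y - y') (B (x - x'))).
have h3 := ler_wpM2l g0 (bb (x - x')).
rewrite [leRHS]eE; move: (e / _) d0 xx yy => d d0 xx yy.
have h4 := ler_wpM2l g0 (ltW yy).
have h5 := ler_wpM2l (mulr_ge0 g0 b0) (ltW xx).
lra.
Qed.

Lemma conjugate_dual_ip (h : H) (f : E -> H) (c : R) : linear f -> 0 <= c ->
  (forall u, nrm (f u) <= c * nrm u) -> conjugate_dual (fun u => ip h (f u)).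
Proof.
move=> lf c0 bf; split=> [a u v|].
  by rewrite lf ipDr ipZr /=; congr (_ * _ + _); rewrite conjE.
(* The factor 2 comes from bounding the real and the imaginary part separately. *)
exists (2 * nrm h * c)%:C; split=> [|u].
  by rewrite ler0c !mulr_ge0 ?nrm_ge0.
rewrite nrmE -rmorphM; apply: le_trans (normc_le_ReIm _) _; rewrite lecR.
rewrite -rip_i -/(re_ip ip h (f u)).
have := cauchy_schwarz hilb h (f u).
have := cauchy_schwarz hilb h ('i%C *: f u); rewrite nrmZi.
have := ler_wpM2l (nrm_ge0 h) (bf u); lra.
Qed.

Section Perturbed.
Variable B : H -> H.
Hypothesis bB : bounded_operator B.
Hypothesis qc : q_closed Omega.
Hypothesis dD : dense [set x | D x].
Hypothesis injB : forall u,
  (forall v, Omega u v + ip (B (val u)) (val v) = 0) -> u = 0.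
Hypothesis surjB : forall L, conjugate_dual L ->
  exists u, forall v, L v = Omega u v + ip (B (val u)) (val v).
Hypothesis hyp : hyper_solvable ip Omega.
Let T := form_operator ip Omega.
Let S := op_plus T B.

Let lB : linear B. Proof. by case: bB. Qed.

Lemma sub_embedding : exists2 c : R, 0 <= c & forall u, nrm (val u : H) <= c * nrm u.
Proof.
have [[a a0 ba] _ _] := qc; exists (Re a); first by have := Re_le (ltW a0).
by move=> u; have := Re_le (ba u); rewrite -[a in X in X -> _](RRe_real (gtr0_real a0)) ReM_real.
Qed.

(** The solution is kept in E, not in H: its boundedness for the norm of the form follows from the
    closed graph theorem, the graph being closed because solutions are unique and all terms of the
    equation are continuous. *)
Lemma perturbed_solution : exists2 G : H -> E, bounded_operator G &
  forall h u, (forall v, Omega u v + ip (B (val u)) (val v) = ip h (val v))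
    <-> u = G h.
Proof.
have [a a0 ba] := sub_embedding.
have solve h : exists u, forall v,
    Omega u v + ip (B (val u)) (val v) = ip h (val v).
  have [|u uP] := surjB (L := fun v => ip h (val v)); last first.
    by exists u => v; rewrite -uP.
  split=> [c u v|].
    by rewrite valD valZ ipDr ipZr; congr (_ * _ + _); rewrite conjE.
  exists (2 * nrm h * a)%:C; split=> [|u].
    by rewrite ler0c !mulr_ge0 ?nrm_ge0.
  rewrite nrmE -rmorphM; apply: le_trans (normc_le_ReIm _) _; rewrite lecR.
  rewrite -rip_i -/(re_ip ip h (val u)).
  have := cauchy_schwarz hilb h (val u).
  have := cauchy_schwarz hilb h ('i%C *: val u); rewrite nrmZi.
  have := ler_wpM2l (nrm_ge0 h) (ba u); lra.
have [G GP] := choice solve.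
have uniq h u : (forall v, Omega u v + ip (B (val u)) (val v) = ip h (val v)) ->
    u = G h.
  move=> uh; apply: subr0_eq; apply: injB => v.
  rewrite OmegaDl OmegaNl valB (linB lB) ipDl ipNl addrACA -opprD uh GP.
  exact: subrr.
have lG : linear G.
  move=> c x y; apply/esym/uniq => v.
  rewrite OmegaDl OmegaZl valD valZ lB !ipDl !ipZl -(GP x v) -(GP y v) mulrDr.
  exact: addrACA.
exists G; last by move=> h u; split=> [|->]; [exact: uniq | exact: GP].
split=> //; have [_ _ /bounded_form_Re [c c0 bc]] := qc.
have [b b0 bb] := bounded_map_nrm bB.2.
have [|k k0 kP] := @closed_graph_bounded R H E G lG; last exact: nrm_bounded_map kP.
move=> h u cl; apply: uniq => v; apply: subr0_eq.
pose f v := Omega u v + ip (B (val u)) (val v) - ip h (val v).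
(* The defect f is conjugate-linear, so it is enough that its real part vanishes; M collects the
   three continuity constants at w. *)
apply: (@conj_linear_Re0 _ f) => [t w|w].
  by rewrite /f OmegaZr valZ !ipZr mulrBr mulrDr.
apply/eqP; rewrite -normr_le0; apply/ler_addgt0Pr => e e0; rewrite add0r.
pose M := c * nrm w + b * a * nrm (val w : H) + nrm (val w : H) + 1.
have w0 := nrm_ge0 w; have vw0 := nrm_ge0 (val w : H).
have M0 : 0 < M.
  by rewrite /M; have := mulr_ge0 c0 w0; have := mulr_ge0 (mulr_ge0 b0 a0) vw0; lra.
have d0 : 0 < e / M by rewrite divr_gt0.
have eE : e = e / M * M by rewrite divfK // gt_eqF.
have [h' [hh uG]] := cl _ d0.
have -> : Re (f w) = Re (Omega (u - G h') w) + rip (B (val (u - G h'))) (val w)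
    - rip (h - h') (val w).
  rewrite /re_ip -ReD -ReN -ReD; congr (Re _); rewrite /f.
  rewrite OmegaDl OmegaNl valB (linB lB) !ipDl !ipNl -(GP h').
  by ring.
apply: le_trans (ler_normB _ _) _.
apply: le_trans (lerD (ler_normD _ _) (lexx _)) _.
have h1 := bc (u - G h') w.
have h2 := cauchy_schwarz hilb (B (val (u - G h'))) (val w).
have h3 := cauchy_schwarz hilb (h - h') (val w).
have h4 := le_trans (bb (val (u - G h'))) (ler_wpM2l b0 (ba (u - G h'))).
apply: le_trans (lerD (lerD h1 h2) h3) _.
rewrite eE /M; move: (e / _) d0 hh uG => d d0 hh uG.
have g1 := ler_wpM2r w0 (ler_wpM2l c0 (ltW uG)).
have g2 := ler_wpM2r vw0 (le_trans h4 (ler_wpM2l b0 (ler_wpM2l a0 (ltW uG)))).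
have g3 := ler_wpM2r vw0 (ltW hh).
lra.
Qed.

(* The operators T and S = T + B have the same domain, hence so do |T| and |S|,
   whose graph norms are then comparable; heinz_domain, applied in both
   directions, transfers this to the square roots. *)
Lemma sqrt_abs_perturbed : exists W : H -> H,
  [/\ bounded_positive ip W, forall y, W y = 0 -> y = 0,
      op_sqrt ip (op_abs ip S) = inverse_graph W &
      forall x, D x <-> exists y, x = W y].
Proof.
have [GE [lGE [gM bGE]] GEP] := perturbed_solution.
pose G h : H := val (GE h).
have lG : linear G by move=> c x y; rewrite /G lGE valD valZ.
have [a a0 ba] := sub_embedding.
have [g g0 bG] : exists2 g : R, 0 <= g & forall h, nrm (G h) <= g * nrm h.
  have [k k0 kP] := bounded_map_nrm (ex_intro _ gM bGE).
  exists (a * k); first exact: mulr_ge0.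
  by move=> h; rewrite -mulrA; apply: le_trans (ba _) (ler_wpM2l a0 (kP h)).
have bopG : bounded_operator G by split=> //; exact: nrm_bounded_map bG.
have [b b0 bb] := bounded_map_nrm bB.2.
have TE x y : T (x, y) <-> x = G (y + B x).
  rewrite /T /form_operator /=; split=> [[u <- uy]|xG].
    congr val; apply/GEP => v; by rewrite uy -ipDl.
  exists (GE (y + B x)) => [//|v].
  have := (GEP (y + B x) (GE (y + B x))).2 erefl v.
  by rewrite -/(G _) -xG ipDl => /addIr.
have TEset : T = [set p | p.1 = G (p.2 + B p.1)].
  by apply/seteqP; split=> -[x y] /TE.
have SE x y : S (x, y) <-> x = G y.
  rewrite /S /op_plus /=; split=> [[w [/TE xw ->]] //|xG].
  by exists (y - B x); rewrite subrK; split=> //; apply/TE; rewrite subrK.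
have lT : lin_graph T.
  rewrite TEset; split=> /= [|c x y x' y' xG xG'].
    by rewrite (lin0 lB) addr0 (lin0 lG).
  by rewrite {1}xG {1}xG' -lG lB scalerDr addrACA.
have cT : closed_graph T by rewrite TEset; exact: closed_shifted_inverse.
have fT : functional_graph T.
  move=> y [u u0 uy]; apply: (dense_orth hilb dD) => x /sub_surj [v <-].
  rewrite ipC; have := uy v.
  have -> : u = 0 by apply: val_inj; rewrite u0 val0.
  by rewrite linear0l => <-; rewrite conjc0.
have [_ domD] := hyp.
have [sp posp pp] : [/\ selfadjoint ip (op_sqrt ip (op_abs ip T)),
    positive ip (op_sqrt ip (op_abs ip T)) &
    op_comp (op_sqrt ip (op_abs ip T)) (op_sqrt ip (op_abs ip T)) = op_abs ip T].
  apply: op_sqrt_neq0; have : [set x | D x] (val (0 : E)) by exact: valP.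
  by rewrite domD => -[y yP]; exists (val (0 : E), y).
set p := op_sqrt ip (op_abs ip T) in sp posp pp domD.
have [sP posP PP] : [/\ selfadjoint ip (op_abs ip T), positive ip (op_abs ip T) &
    op_comp (op_abs ip T) (op_abs ip T) = op_comp (op_adjoint ip T) T].
  apply: op_sqrt_neq0; rewrite -/(op_abs ip T) -pp; exists (0, 0), 0.
  by split; exact: (selfadjoint_lin sp).1.
set P := op_abs ip T in sP posP PP pp.
have lP := selfadjoint_lin sP; have cP := selfadjoint_closed hilb sP.
have fP := selfadjoint_functional hilb sP.
(* D(P) is dense and D(P*P) is a core of P; as P*P = T*T, this core lies in D(T). *)
have dT : dense (op_dom T).
  apply/denseP => x e e0; have e2 : 0 < e / 2 by lra.
  have [x1 [y1 Px1] xx1] := (denseP _).1 sP.1 x _ e2.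
  have [x2 [y2 [z2 [Px2 adj xx2 _]]]] := adjoint_comp_core hilb lP cP fP Px1 e2.
  have : op_comp P P (x2, z2) by exists y2; rewrite -[in P (y2, _)]sP.2.
  rewrite PP => -[w [Tw _]]; exists x2; first by exists w.
  by have := nrm_tri x x1 x2; lra.
have SEset : S = inverse_graph G by apply/seteqP; split=> -[x y] /SE.
have lS : lin_graph S.
  rewrite SEset; split=> [|c x y x' y' /inverse_graphP -> /inverse_graphP ->].
    by rewrite /inverse_graph /= (lin0 lG).
  by rewrite /inverse_graph /= lG.
have cS : closed_graph S.
  have b00 : bounded_operator ((fun=> 0) : H -> H).
    split=> [c x y|]; first by rewrite scaler0 addr0.
    by apply: (@nrm_bounded_map _ _ _ 0) => x; rewrite nrm0 mul0r.
  rewrite SEset [inverse_graph G](_ : _ = [set p | p.1 = G (p.2 + 0)]).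
    exact: (closed_shifted_inverse bopG b00).
  by apply/seteqP; split=> -[x y] /=; rewrite addr0.
have fS : functional_graph S.
  move=> y /SE y0; have := (TE 0 y).2; rewrite (lin0 lB) addr0 => /(_ y0).
  exact: fT.
have [Gs GsP] : {Gs : H -> H & forall z y, ip z (G y) = ip (Gs z) y}.
  apply: (@choice _ _ (fun z w : H => forall y, ip z (G y) = ip w y)) => z.
  apply: (@riesz _ _ _ hilb (fun y => ip z (G y)) (nrm z * g)) => [c x y|x].
    by rewrite lG ipDr ipZr.
  apply: le_trans (cauchy_schwarz hilb _ _) _; rewrite -mulrA.
  by rewrite ler_wpM2l ?nrm_ge0.
(* [Gs] is the adjoint of G, and K will be the inverse of S*S. *)
pose K z := G (Gs z).
have K2 x : rip (K x) x = nrm (Gs x) ^+ 2.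
  by rewrite ripC /re_ip GsP -/(re_ip _ _ _) -(nrm2 hilb).
have pK : bounded_positive ip K.
  split=> [x y||x]; last by rewrite K2 sqr_ge0.
    by rewrite ipC !GsP -ipC.
  exists (g * g) => x; apply: le_trans (bG _) _; rewrite -mulrA ler_wpM2l //.
  have := K2 x; have := rip_le hilb (K x) x; have := bG (Gs x).
  rewrite -/(K x) => h1 h2 h3; have h4 := nrm_ge0 (Gs x); have h5 := nrm_ge0 x.
  have h6 := ler_wpM2r h5 h1.
  (* From |Gs x|^2 = <K x, x> <= g |Gs x| |x|, cancel |Gs x|. *)
  have [->|Gs0] := eqVneq (nrm (Gs x)) 0; first exact: mulr_ge0.
  have Gs_gt0 : 0 < nrm (Gs x) by rewrite lt_def Gs0.
  by rewrite -(ler_pM2l Gs_gt0); lra.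
(* The kernel of [Gs] is orthogonal to the range of G, which contains the dense D(T). *)
have kK y : K y = 0 -> y = 0.
  move=> Ky; have Gs0 : Gs y = 0.
    by apply: nrm_eq0; apply/eqP; rewrite -sqrf_eq0 -K2 Ky rip0l.
  apply: (dense_orth hilb dT) => x [w /TE ->].
  by rewrite ipC GsP Gs0 ip0l conjc0.
have SsE : op_comp (op_adjoint ip S) S = inverse_graph K.
  have adjE y z : op_adjoint ip S (y, z) <-> y = Gs z.
    split=> [adj|-> x w /SE -> /=].
      apply: (ip_injr hilb) => w; rewrite [RHS]ipC -GsP -ipC.
      by apply: adj; apply/SE.
    by rewrite ipC -GsP -ipC.
  apply/seteqP; split=> -[x z].
    by move=> [y [/SE xG /adjE yG]]; apply/inverse_graphP; rewrite /K -[Gs z]yG.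
  by move=> /= xK; exists (Gs z); split; [apply/SE|apply/adjE].
have [Z [pZ ZZ absE]] := op_sqrt_inverse hilb pK kK.
have kZ y : Z y = 0 -> y = 0.
  move=> Zy; apply: kK; rewrite -ZZ Zy; apply: lin0.
  by have [sZ _ _] := pZ; exact: (symmetric_linear hilb sZ).
have [W [pW WW sqrtE]] := op_sqrt_inverse hilb pZ kZ.
have kW y : W y = 0 -> y = 0.
  move=> Wy; apply: kZ; rewrite -WW Wy; apply: lin0.
  by have [sW _ _] := pW; exact: (symmetric_linear hilb sW).
have sqE : op_sqrt ip (op_abs ip S) = inverse_graph W.
  by rewrite /op_abs SsE absE.
exists W; split=> //.
have sQ : selfadjoint ip (inverse_graph W).
  by apply: inverse_selfadjoint kW => //; case: pW.
have sP' : selfadjoint ip (inverse_graph Z).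
  by apply: inverse_selfadjoint kZ => //; case: pZ.
have QQ : op_comp (inverse_graph W) (inverse_graph W) = inverse_graph Z.
  apply/seteqP; split=> -[x z].
    move=> [y [/inverse_graphP xW /inverse_graphP yW]].
    by apply/inverse_graphP; rewrite -WW -[W z]yW.
  by move=> /inverse_graphP ->; exists (W z); rewrite -WW.
have P'P' : op_comp (op_adjoint ip (inverse_graph Z)) (inverse_graph Z) =
    op_comp (op_adjoint ip S) S.
  rewrite sP'.2 SsE; apply/seteqP; split=> -[x z].
    move=> [y [/inverse_graphP xZ /inverse_graphP yZ]].
    by apply/inverse_graphP; rewrite -ZZ -[Z z]yZ.
  by move=> /inverse_graphP ->; exists (Z z); rewrite -ZZ.
have PadjP : op_comp (op_adjoint ip P) P = op_comp (op_adjoint ip T) T.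
  by rewrite sP.2.
have lP' := selfadjoint_lin sP'; have cP' := selfadjoint_closed hilb sP'.
have fP' := selfadjoint_functional hilb sP'.
have eq_sub (A C : set (H * H)) : A = C -> A `<=` C by move=> ->.
have PT := same_square_extension hilb lP cP fP lT cT fT (eq_sub _ _ PadjP).
have TP := same_square_extension hilb lT cT fT lP cP fP (eq_sub _ _ (esym PadjP)).
have P'S := same_square_extension hilb lP' cP' fP' lS cS fS (eq_sub _ _ P'P').
have SP' := same_square_extension hilb lS cS fS lP' cP' fP' (eq_sub _ _ (esym P'P')).
(* |P' x| <= |S x| <= |T x| + b |x| <= |P x| + b |x|. *)
have PP' (x v : H) : P (x, v) ->
    exists2 y, inverse_graph Z (x, y) & nrm y <= nrm v + b * nrm x.
  move=> /PT [w Tw wv]; have Sx : S (x, w + B x) by exists w.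
  have [y P'y yw] := SP' _ _ Sx; exists y => //.
  have := nrmD w (B x); have := bb x; lra.
have P'P (x v : H) : inverse_graph Z (x, v) ->
    exists2 y, P (x, y) & nrm y <= nrm v + b * nrm x.
  move=> /P'S [w [t [/= Tt wt]] wv]; have [y Py yt] := TP _ _ Tt; exists y => //.
  have tE : t = w - B x by rewrite wt addrK.
  have := nrmD w (- B x); rewrite nrmN -tE; have := bb x; lra.
have dom1 := heinz_domain hilb sp posP sP pp sQ sP' QQ b0 PP'.
have dom2 := heinz_domain hilb sQ (inverse_positive pZ) sP' QQ sp sP pp b0 P'P.
move=> x; have Dx : D x = op_dom p x :> Prop by rewrite -domD.
split=> [|[y ->]].
  by rewrite Dx => /dom1 [y /inverse_graphP ->]; exists y.
suff : op_dom p (W y) by rewrite -domD.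
by apply: dom2; exists y.
Qed.

(** V is the Riesz operator of the form pulled back along W, the inverse of the root of |S|.
    Bijectivity is conditional on solvability of Omega itself, so that the same lemma serves B and
    the zero perturbation. *)
Lemma representation : exists V : H -> H,
  [/\ bounded_operator V,
    represented_by ip Omega (op_sqrt ip (op_abs ip S)) V,
    forall V', represented_by ip Omega (op_sqrt ip (op_abs ip S)) V' -> V' = V &
    (forall u, (forall v, Omega u v = 0) -> u = 0) ->
    (forall L, conjugate_dual L -> exists u, forall v, L v = Omega u v) ->
    bijective V].
Proof.
have [W [[sW [w bW] _] kW sqE domE]] := sqrt_abs_perturbed.
have lW := symmetric_linear hilb sW.
have injW x y : W x = W y -> x = y.
  by move=> xy; apply: subr0_eq; apply: kW; rewrite (linB lW) xy subrr.
have [WE WEP] : {WE : H -> E & forall h, val (WE h) = W h}.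
  apply: (@choice _ _ (fun h u => val u = W h)) => h.
  by apply: sub_surj; apply/domE; exists h.
have lWE : linear WE.
  by move=> c x y; apply: val_inj; rewrite valD valZ !WEP lW.
have [a a0 ba] := sub_embedding.
have [|k k0 bWE] := @closed_graph_bounded R H E WE lWE.
  move=> h u cl; apply: val_inj; rewrite WEP.
  apply/eqP; rewrite -subr_eq0; apply/eqP/nrm_small => e e0.
  have aw : 0 < a + `|w| + 1 by have := normr_ge0 w; lra.
  have d0 : 0 < e / (a + `|w| + 1) by rewrite divr_gt0.
  have eE : e = e / (a + `|w| + 1) * (a + `|w| + 1) by rewrite divfK // gt_eqF.
  have [h' [hh uh]] := cl _ d0.
  have := nrm_tri (val u : H) (val (WE h')) (W h).
  have := ba (u - WE h'); rewrite valB => h1.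
  rewrite {2}WEP -(linB lW) => h2.
  have h3 := bW (h' - h); rewrite (nrmB h') in h3.
  have h4 := ler_wpM2r (nrm_ge0 (h - h')) (ler_norm w).
  move: h1 h2; rewrite WEP => h1 h2.
  rewrite eE; move: (e / _) d0 hh uh => d d0 hh uh.
  have := normr_ge0 w; nra.
have [_ _ /bounded_form_Re [c c0 bc]] := qc.
have bf x y : `|Re (Omega (WE x) (WE y))| <= c * (k * k) * nrm x * nrm y.
  apply: le_trans (bc _ _) _.
  have h1 := ler_pM (nrm_ge0 _) (nrm_ge0 _) (bWE x) (bWE y).
  by have := ler_wpM2l c0 h1; lra.
have [V VP] : {V : H -> H & forall x y, Omega (WE x) (WE y) = ip (V x) y}.
  apply: (@choice _ _ (fun x v : H => forall y, Omega (WE x) (WE y) = ip v y)) => x.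
  apply: (@riesz _ _ _ hilb (fun y => Omega (WE x) (WE y)) _ _ (bf x)) => t y z.
  by rewrite lWE OmegaDr OmegaZr.
exists V; split.
- split=> [t x y|].
    by apply: (ip_inj hilb) => z; rewrite ipDl ipZl -!VP lWE OmegaDl OmegaZl.
  apply: (@nrm_bounded_map _ _ _ (c * (k * k))) => x.
  have := le_trans (ler_norm _) (bf x (V x)); rewrite VP -/(re_ip _ _ _) -(nrm2 hilb).
  have [->|V0] := eqVneq (nrm (V x)) 0.
    by rewrite !mulr_ge0 ?nrm_ge0 // ltW.
  have Vp : 0 < nrm (V x) by rewrite lt_def V0 nrm_ge0.
  by rewrite expr2 ler_pM2r.
- move=> u v; rewrite sqE.
  have [[x ux] [y vy]] := ((domE (val u)).1 (valP u), (domE (val v)).1 (valP v)).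
  exists x, y; split; [exact/inverse_graphP | exact/inverse_graphP |].
  rewrite -VP; congr (Omega _ _); apply: val_inj; by rewrite WEP.
- move=> V'; rewrite sqE => V'P; apply/funext => x; apply: (ip_inj hilb) => y.
  have [qx [qy [/inverse_graphP + /inverse_graphP + e]]] := V'P (WE x) (WE y).
  by rewrite !WEP => /injW xE /injW yE; rewrite -VP e xE yE.
move=> injO surjO.
have [QE QEP] : {QE : E -> H & forall u, val u = W (QE u)}.
  apply: (@choice _ _ (fun (u : E) (h : H) => val u = W h)) => u.
  exact: (domE (val u)).1 (valP u).
have WQ u : WE (QE u) = u by apply: val_inj; rewrite WEP QEP.
have QW x : QE (WE x) = x by apply: injW; rewrite -QEP WEP.
have lQE : linear QE.
  by move=> c' u v; apply: injW; rewrite lW -!QEP valD valZ.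
have [|q q0 bQE] := @closed_graph_bounded R E H QE lQE.
  move=> u y cl; apply: injW; rewrite -QEP.
  apply/eqP; rewrite -subr_eq0; apply/eqP/nrm_small => e e0.
  have aw : 0 < a + `|w| + 1 by have := normr_ge0 w; lra.
  have d0 : 0 < e / (a + `|w| + 1) by rewrite divr_gt0.
  have eE : e = e / (a + `|w| + 1) * (a + `|w| + 1) by rewrite divfK // gt_eqF.
  have [u' [uu yu]] := cl _ d0.
  have := nrm_tri (W y) (W (QE u')) (val u : H).
  rewrite -(linB lW) -QEP -valB => h1.
  have h2 := ba (u' - u); rewrite (nrmB u') in h2.
  have h3 := bW (y - QE u').
  have h4 := ler_wpM2r (nrm_ge0 (y - QE u')) (ler_norm w).
  rewrite eE; move: (e / _) d0 uu yu => d d0 uu yu.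
  have := normr_ge0 w; nra.
(* Since [QE] is bounded from E to H, u |-> <z, QE u> is a conjugate functional on E; if Omega u
   represents it, then V (QE u) = z. *)
have [V' V'P] : {V' : H -> H & forall z, V (V' z) = z}.
  apply: (@choice _ _ (fun z x : H => V x = z)) => z.
  have [u uP] := surjO _ (conjugate_dual_ip z lQE (ltW q0) bQE).
  exists (QE u); apply: (ip_inj hilb) => y.
  by rewrite -VP WQ -uP QW.
have injV x y : V x = V y -> x = y.
  move=> xy; rewrite -[x]QW -[y]QW; congr QE; apply: subr0_eq; apply: injO => v.
  by rewrite OmegaDl OmegaNl -[v]WQ !VP xy subrr.
by exists V' => // x; apply: injV; rewrite V'P.
Qed.

End Perturbed.
End Forms.

Theorem theorem4p8 (R : realType) (H : completeNormedModType R[i])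
    (ip : {dot H for Num.conj}) (D : pred H) (E : subBanachType D)
    (Omega : {sesquilinear E}) (T : set (H * H))
    (Ups : {sesquilinear H}) (B : H -> H) :
  hilbert ip ->
  dense [set x | D x] ->
  solvable Omega ->
  T = form_operator ip Omega ->
  solving_perturbation Omega Ups ->
  bounded_operator B ->
  (forall x y, Ups x y = ip (B x) y) ->
  hyper_solvable ip Omega ->
  (exists! V : H -> H, bounded_operator V /\
     represented_by ip Omega (op_sqrt ip (op_abs ip (op_plus T B))) V) /\
  (0 \in resolvent_set T ->
   exists! W : H -> H, [/\ bounded_operator W, bijective W &
     represented_by ip Omega (op_sqrt ip (op_abs ip T)) W]).
Proof.
move=> hilb dD [qc _] TE [_ injU surjU] bB UpsE hyp.
have surjB L : conjugate_dual L ->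
    exists u, forall v, L v = Omega u v + ip (B (val u)) (val v).
  by move=> /surjU [u uP]; exists u => v; rewrite uP UpsE.
split.
  have injB u : (forall v, Omega u v + ip (B (val u)) (val v) = 0) -> u = 0.
    by move=> u0; apply: injU => v; rewrite UpsE.
  have [V [bV VP Vu _]] := representation hilb bB qc dD injB surjB hyp.
  rewrite TE; exists V; split=> // V' [_ V'P]; exact/esym/Vu.
rewrite in_setE => -[G [lG _] GP].
pose O : H -> H := fun=> 0.
have TO : op_plus T O = T.
  apply/seteqP; split=> -[x y].
    by move=> [w [/= Tw ->]]; rewrite /O addr0.
  by move=> Txy; exists y; rewrite /O addr0.
have TG x y : T (x, y) <-> x = G y.
  rewrite -GP; split=> [Txy|[w [/= Tw ->]]].
    by exists y; rewrite /= scale0r subr0.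
  by rewrite scale0r subr0.
have bO : bounded_operator O.
  split=> [c x y|]; first by rewrite /O scaler0 addr0.
  by apply: (@nrm_bounded_map _ _ _ _ 0) => x; rewrite nrm0 mul0r.
have injO u : (forall v, Omega u v = 0) -> u = 0.
  move=> u0; have : T (val u, 0).
    by rewrite TE; exists u => // v; rewrite u0 ip0l.
  move=> /TG uG; apply: val_inj; rewrite uG (lin0 lG); exact/esym/val0.
(* If L = Omega u + <B u, .>, pick u' with T u' = B u; then Omega (u + u') = L. *)
have surjO L : conjugate_dual L -> exists u, forall v, L v = Omega u v.
  move=> /surjB [u uP].
  have : T (G (B (val u)), B (val u)) by apply/TG.
  rewrite TE => -[u' _ u'P]; exists (u + u') => v.
  by rewrite uP OmegaDl u'P.
have injO' u : (forall v, Omega u v + ip (O (val u)) (val v) = 0) -> u = 0.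
  by move=> u0; apply: injO => v; rewrite -[RHS](u0 v) ip0l addr0.
have surjO' L : conjugate_dual L ->
    exists u, forall v, L v = Omega u v + ip (O (val u)) (val v).
  by move=> /surjO [u uP]; exists u => v; rewrite ip0l addr0.
have [W [bW WP Wu Wb]] := representation hilb bO qc dD injO' surjO' hyp.
rewrite -TE TO in WP Wu.
exists W; split=> [|W' [_ _ W'P]]; last exact/esym/Wu.
by split=> //; exact: Wb.
Qed.
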